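(* Let $(\Omega,\mathcal{F},P)$ be a purely atomic probability space, let $K\in\mathbb{N}$, let $\mathcal{G}_1,\dots,\mathcal{G}_K$ be sub-$\sigma$-fields of $\mathcal{F}$, and let $\mathcal{F}_1,\mathcal{F}_2,\dots\in\{\mathcal{G}_1,\dots,\mathcal{G}_K\}$. Let $p\geq1$ be a real number, let $X_0\in L^p(\Omega,\mathcal{F},P)$, and define successively $$X_n=E(X_{n-1}\mid\mathcal{F}_n),\quad n\geq1.$$ Then $\{X_n\}$ converges to some $X_\infty\in L^p(\Omega,\mathcal{F},P)$ in $L^p$-norm and almost everywhere. Moreover, if each $\mathcal{G}_k$ ($1\le k\le K$) occurs infinitely often in the sequence $\{\mathcal{F}_n\}$, then $$X_\infty=E\left(X_0\,\middle|\,\bigcap_{k=1}^K\overline{\mathcal{G}_k}\right)\quad\text{almost surely}.$$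
   Context: $E(\cdot\mid\mathcal{G})$ denotes conditional expectation on $(\Omega,\mathcal{F},P)$. A set $B\in\mathcal{F}$ is called atomic if $P(B)>0$ and every $\mathcal{F}$-measurable set $A\subset B$ satisfies $P(A)=0$ or $P(A)=P(B)$. The probability space is called purely atomic if $\mathcal{F}$ contains a countable (finite or infinite) number of atomic sets $B_1,B_2,\dots$ with $\sum_{i\geq1}P(B_i)=1$ and $P(B_i\cap B_j)=0$ for $i\neq j$. Let $\mathcal{N}$ be the collection of all null sets of $(\Omega,\mathcal{F},P)$ (sets in $\mathcal{F}$ of probability $0$); for a sub-$\sigma$-field $\mathcal{G}$ of $\mathcal{F}$, $\overline{\mathcal{G}}$ is the $\sigma$-field generated by $\mathcal{G}$ and $\mathcal{N}$. *)

(* Defs.v *)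
From mathcomp Require Import all_boot all_order all_algebra.
From mathcomp Require Import all_classical all_reals all_analysis.

Set Implicit Arguments.
Unset Strict Implicit.
Unset Printing Implicit Defensive.

Import Order.TTheory GRing.Theory Num.Theory.
Import numFieldNormedType.Exports.

Local Open Scope classical_set_scope.
Local Open Scope ring_scope.
Local Open Scope ereal_scope.

Definition atomic (d : measure_display) (T : measurableType d) (R : realType)
    (P : probability T R) (B : set T) : Prop :=
  [/\ measurable B, 0 < P B &
      forall A, measurable A -> A `<=` B -> P A = 0 \/ P A = P B].

(* The index set [I] makes the family of atoms finite or countably infinite. *)
Definition purely_atomic (d : measure_display) (T : measurableType d)
    (R : realType) (P : probability T R) : Prop :=
  exists (I : set nat) (B : nat -> set T),
    [/\ forall i, I i -> atomic P (B i),
        forall i j, I i -> I j -> i <> j -> P (B i `&` B j) = 0 &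
        \esum_(i in I) P (B i) = 1].

Definition sub_sigma_field (d : measure_display) (T : measurableType d)
    (G : set (set T)) : Prop :=
  sigma_algebra [set: T] G /\ G `<=` measurable.

Definition null_sets (d : measure_display) (T : measurableType d)
    (R : realType) (P : probability T R) : set (set T) :=
  [set N | measurable N /\ P N = 0].

Definition sigma_completion (d : measure_display) (T : measurableType d)
    (R : realType) (P : probability T R) (G : set (set T)) : set (set T) :=
  <<s G `|` null_sets P >>.

(* [Y] is a version of E(X | G). Conditional expectations are determined only
   up to P-null sets, hence a relation instead of a function of [X].
   The first clause is measurability with respect to [<<s G >>], which is [G]
   itself when [G] is a sigma-field. *)
Definition is_cond_exp (d : measure_display) (T : measurableType d)
    (R : realType) (P : probability T R) (G : set (set T)) (X Y : T -> R)
    : Prop :=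
  [/\ measurable_fun [set: g_sigma_algebraType G] (Y : g_sigma_algebraType G -> R),
      P.-integrable [set: T] (EFin \o Y) &
      forall A, G A -> \int[P]_(w in A) (Y w)%:E = \int[P]_(w in A) (X w)%:E].

(* Main.v *)
Require Import Defs.
From mathcomp Require Import all_boot all_order all_algebra.
From mathcomp Require Import all_classical all_reals all_analysis.
From mathcomp Require Import measurable_realfun.
From mathcomp Require Import ring lra.

(* On a purely atomic space a measurable function is, up to a null set, a
   sequence of values on the atoms. Conditioning decreases E phi for every convex
   phi; with phi(x) = sqrt (1 + x^2), whose strict convexity is quantitative and
   whose linear growth makes it available already for p = 1, this bounds the
   values of X_n on each atom and forces X_(n+1) - X_n to tend to 0 there. A
   diagonal argument gives a subsequence converging to some x, in L^p as well,
   because the tails E (|X_n| - L)_+^p are dominated by those of X_0. As long as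
   the sigma-fields used make x measurable (up to null sets), E |X_n - x|^p does
   not increase; hence at the first use of another one X_n is still close to x,
   and so is its conditional expectation. If this occurred infinitely often, x
   would be a limit of functions measurable for one of these sigma-fields. So x
   is measurable for all the sigma-fields used from some time on, E |X_n - x|^p is
   eventually nonincreasing, and the whole sequence converges to x. *)

Set Implicit Arguments.
Unset Strict Implicit.
Unset Printing Implicit Defensive.

Import Order.TTheory GRing.Theory Num.Theory.
Import numFieldNormedType.Exports.

Local Open Scope classical_set_scope.
Local Open Scope ring_scope.

(** * Measurability with respect to a sub-sigma-field *)

Section sub_sigma_algebra.
Context {d : measure_display} {T : measurableType d} {R : realType}.
Implicit Types (G : set (set T)) (f : T -> R).

Definition measurable_wrt G f :=
  measurable_fun [set: g_sigma_algebraType G] (f : g_sigma_algebraType G -> R).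

Lemma sub_sigma_field_measurable G A :
  sub_sigma_field G -> <<s G >> A -> measurable A.
Proof.
by move=> [sG GT]; rewrite sigma_algebra_id//; exact: GT.
Qed.

Lemma measurable_wrt_measurable G f :
  sub_sigma_field G -> measurable_wrt G f -> measurable_fun setT f.
Proof.
move=> sG mf _ B mB; apply: (sub_sigma_field_measurable sG).
exact: (mf measurableT B mB).
Qed.

Lemma measurable_wrtP G f : sigma_algebra [set: T] G ->
  measurable_wrt G f <-> forall B, measurable B -> G (f @^-1` B).
Proof.
move=> sG; split => [mf B mB|mf _ B mB].
  rewrite -(setTI (f @^-1` B)) -(sigma_algebra_id sG).
  exact: (mf measurableT B mB).
by rewrite setTI; apply: sub_sigma_algebra; exact: mf.
Qed.

End sub_sigma_algebra.

(** * Integration against bounded functions measurable for a sub-sigma-field *)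

Section test_functions.
Context {d : measure_display} {T : measurableType d} {R : realType}.
Variables (P : probability T R) (G : set (set T)).
Hypothesis sG : sub_sigma_field G.
Variable f : T -> R.
Hypothesis f_int : P.-integrable setT (EFin \o f).
Hypothesis f0 : forall A, G A -> (\int[P]_(w in A) (f w)%:E = 0)%E.

Import HBNNSimple.

(** A simple function is a finite combination of indicators of its level sets; these lie in [G], and
    [f] integrates to 0 over each of them. *)
Local Lemma integral_mul_nnsfun (g : {nnsfun g_sigma_algebraType G >-> R}) :
  (\int[P]_w (f w * g w)%:E = 0)%E.
Proof.
have Gs y : <<s G >> (g @^-1` [set y]).
  rewrite -(setTI (_ @^-1` _)).
  exact: (@measurable_funPT _ _ _ _ g measurableT [set y] (measurable_set1 y)).
have mg y : d.-measurable (g @^-1` [set y]).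
  by apply: (sub_sigma_field_measurable sG); exact: Gs.
have Gg y : G (g @^-1` [set y]).
  by move: (Gs y); rewrite {1}(sigma_algebra_id sG.1).
have f_ind y : P.-integrable setT
    (fun w => (f w * \1_(g @^-1` [set y]) w)%:E).
  under eq_fun do rewrite EFinM.
  apply: (@integrableMl _ _ _ _ setT) => //.
  exists 1; split => // x x1 t _ /=; rewrite indicE.
  by case: (_ \in _); rewrite ?normr1 ?normr0 ltW// (lt_trans ltr01).
under eq_integral.
  move=> w _; rewrite fimfunE fsbig_finite//= mulr_sumr -sumEFin.
  under eq_bigr.
    move=> y _; rewrite mulrCA mulrC EFinM muleC.
    over.
  over.
rewrite integral_sum//=; last by move=> y; exact: integrableZl.
rewrite big1// => y _; rewrite integralZl//.
rewrite [X in (_ * X)%E](_ : _ = 0%E) ?mule0//.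
rewrite -(f0 (Gg y)) [RHS]integral_mkcond; apply: eq_integral => w _.
by rewrite patchE indicE; case: ifPn => _; rewrite ?mulr1 ?mulr0.
Qed.

(** A nonnegative [W] is an increasing limit of [G]-measurable simple functions, and [M * |f|]
    dominates the products. *)
Lemma integral_mul_bounded0 (W : T -> R) (M : R) : measurable_wrt G W ->
  (forall w, `|W w| <= M) -> (\int[P]_w (f w * W w)%:E = 0)%E.
Proof.
move=> mW WM.
have mf : measurable_fun setT f by apply/measurable_EFinP; case/integrableP: f_int.
have fT : (\int[P]_w (f w)%:E = 0)%E.
  by apply: f0; have [+ _] := sG; case=> s0 sD _; rewrite -(setD0 setT); apply: sD.
(* Adding the constant [M] makes [W] nonnegative and does not change the integral, because [f] has
   total integral 0. *)
wlog W0 : W M mW WM / forall w, 0 <= W w.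
  move=> H.
  have mWT := measurable_wrt_measurable sG mW.
  have e : (\int[P]_w (f w * (W w + M))%:E = 0)%E.
    apply: (H (fun w => W w + M) (M + M)).
    - exact: (@measurable_funD _ (g_sigma_algebraType G)).
    - move=> w; rewrite (le_trans (ler_normD _ _))// lerD// ger0_norm//.
      by rewrite (le_trans _ (WM w)).
    - by move=> w; have := WM w; rewrite ler_norml => /andP[? _]; rewrite -lerBlDr sub0r.
  rewrite -e; under [RHS]eq_integral do rewrite mulrDr EFinD.
  rewrite integralD//=.
  - under [X in (_ + X)%E]eq_integral do rewrite mulrC EFinM.
    by rewrite integralZl// fT mule0 adde0.
  - under eq_fun do rewrite EFinM.
    apply: (@integrableMl _ _ _ _ setT) => //.
    exists M; split; first exact: num_real.
    by move=> x Mx t _; exact: le_trans (WM t) (ltW Mx).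
  - under eq_fun do rewrite mulrC EFinM.
    exact: integrableZl.
have mE : measurable_fun [set: g_sigma_algebraType G]
    (EFin \o W : g_sigma_algebraType G -> \bar R).
  exact/measurable_EFinP.
pose g := nnsfun_approx measurableT mE.
have gW n w : g n w <= W w.
  by rewrite /g nnsfun_approxE -lee_fin; apply: le_approx => // x _; rewrite /= lee_fin.
have mWT := measurable_wrt_measurable sG mW.
have mg n : measurable_fun setT (g n : T -> R).
  by apply: (measurable_wrt_measurable sG); exact: measurable_funPT.
have [] := @dominated_convergence _ _ _ P setT measurableT
   (fun n w => (f w * g n w)%:E) (fun w => (f w * W w)%:E)
   (fun w => M%:E * `|(f w)%:E|)%E.
- move=> n; apply/measurable_EFinP; exact: measurable_funM.
- apply/measurable_EFinP; exact: measurable_funM.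
- apply: aeW => w _.
  under eq_fun do rewrite EFinM; rewrite EFinM.
  apply: cvgeZl => //.
  by apply: (cvg_nnsfun_approx measurableT mE) => // x _; rewrite /= lee_fin.
- apply: integrableZl => //. exact: integrable_abse.
- apply: aeW => w n _ /=.
  rewrite lee_fin normrM mulrC ler_wpM2r// ger0_norm//.
  by rewrite (le_trans (gW n w))// (le_trans _ (WM w))// ler_norm.
move=> _ _; rewrite (_ : [sequence _]_n = cst 0%E); last first.
  by apply/funext => n; exact: integral_mul_nnsfun.
by move/cvg_lim => <-//; rewrite lim_cst.
Qed.

End test_functions.

(** * Conditional Jensen inequality with a gap term *)

Section conditional_expectation.
Context {d : measure_display} {T : measurableType d} {R : realType}.
Variables (P : probability T R).
Implicit Types (G : set (set T)) (X Y : T -> R).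

Lemma integrable_measurable X :
  P.-integrable setT (EFin \o X) -> measurable_fun setT X.
Proof. by case/integrableP => /measurable_EFinP. Qed.

Lemma cond_exp_integral_mul0 G X Y W M : sub_sigma_field G ->
  P.-integrable setT (EFin \o X) -> is_cond_exp P G X Y ->
  measurable_wrt G W -> (forall w, `|W w| <= M) ->
  (\int[P]_w ((X w - Y w) * W w)%:E = 0)%E.
Proof.
move=> sG iX [_ iY XY] mW WM.
apply: (integral_mul_bounded0 sG _ _ mW WM).
  by rewrite (_ : _ \o _ = (EFin \o X) \- (EFin \o Y))%E//; exact: integrableB.
move=> A GA; have mA := sG.2 _ GA.
under eq_integral do rewrite EFinB.
rewrite integralB//=; [|exact: integrableS iX|exact: integrableS iY].
rewrite XY// subee//.
by apply: integrable_fin_num => //; exact: integrableS iX.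
Qed.

(* The term [b] records the gap in the subgradient inequality of [h]. *)
Lemma cond_exp_jensen G X Y (h g : R -> R) (b : T -> R) : sub_sigma_field G ->
  P.-integrable setT (EFin \o X) -> is_cond_exp P G X Y ->
  measurable_fun setT h -> measurable_fun setT g -> measurable_fun setT b ->
  (forall L : R, exists M : R, forall y : R, `|y| <= L -> `|g y| <= M) ->
  (forall x, 0 <= h x) -> (forall w, 0 <= b w) ->
  (forall w, h (Y w) + g (Y w) * (X w - Y w) + b w <= h (X w)) ->
  (\int[P]_w (h (Y w) + b w)%:E <= \int[P]_w (h (X w))%:E)%E.
Proof.
move=> sG iX XY mh mg mb gM h0 b0 hgb.
have [mY iY _] := XY.
have mXT := integrable_measurable iX.
have mYT := integrable_measurable iY.
have mhX : measurable_fun setT (h \o X) by exact: measurableT_comp.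
(* An infinite right-hand side leaves nothing to prove; otherwise [h \o X] is integrable and the
   vanishing integral can be subtracted from it. *)
have [hX|hX] := ltP (\int[P]_w (h (X w))%:E)%E +oo%E; last first.
  by rewrite (le_trans _ hX)// leey.
have ihX : P.-integrable setT (EFin \o (h \o X)).
  apply/integrableP; split; first exact/measurable_EFinP.
  by under eq_integral do rewrite /= ger0_norm//.
(* [g (Y w)] may be unbounded, so it is cut off to sets of [G] on which [Y] is bounded; monotone
   convergence removes the cutoff at the end. *)
pose A n := [set w | `|Y w| <= n%:R].
have GA n : <<s G >> (A n).
  rewrite -[A n]setTI.
  have mnY : measurable_fun [set: g_sigma_algebraType G]
      (fun w : g_sigma_algebraType G => `|Y w|).
    by apply: measurableT_comp => //; exact: normr_measurable.
  have /(_ measurableT [set` `[0, n%:R]]) := mnY.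
  rewrite (_ : _ @^-1` _ = A n); first by apply; apply: measurable_itv.
  by apply/seteqP; split => w /=; rewrite in_itv/= normr_ge0.
have mA n : measurable (A n) := sub_sigma_field_measurable sG (GA n).
pose u w := h (Y w) + b w.
have mu : measurable_fun setT u.
  by apply: measurable_funD => //; exact: measurableT_comp.
have u0 w : 0 <= u w by rewrite addr_ge0.
have step n : (\int[P]_(w in A n) (u w)%:E <= \int[P]_w (h (X w))%:E)%E.
  pose W w := g (Y w) * \1_(A n) w.
  have [M gMn] := gM n%:R.
  have WM w : `|W w| <= Num.max M 0.
    rewrite /W indicE normrM; case: (boolP (w \in A n)) => wA.
      by rewrite normr1 mulr1 le_max gMn//; move: wA; rewrite inE.
    by rewrite normr0 mulr0 le_max lexx orbT.
  have mW : measurable_wrt G W.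
    apply: (@measurable_funM _ (g_sigma_algebraType G)).
      exact: (@measurableT_comp _ _ _ (g_sigma_algebraType G)).
    exact: (@measurable_indic _ (g_sigma_algebraType G) R _ (A n) (GA n)).
  have mWT := measurable_wrt_measurable sG mW.
  have v0 := cond_exp_integral_mul0 sG iX XY mW WM.
  have iv : P.-integrable setT (fun w => ((X w - Y w) * W w)%:E).
    under eq_fun do rewrite EFinM.
    apply: (@integrableMl _ _ _ _ setT) => //.
      rewrite (_ : (fun _ => _) = (EFin \o X) \- (EFin \o Y))%E//.
      exact: integrableB.
    exists (Num.max M 0); split; first exact: num_real.
    by move=> x Mx t _; exact: le_trans (WM t) (ltW Mx).
  have iD : P.-integrable setT (fun w => (h (X w) - (X w - Y w) * W w)%:E).
    rewrite (_ : (fun _ => _) = (EFin \o (h \o X)) \-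
      (fun w => ((X w - Y w) * W w)%:E))%E//.
    exact: integrableB.
  (* On [A n] this follows from the subgradient inequality; off [A n] the weight [W] vanishes and
     [h] is nonnegative. *)
  have D0 w : 0 <= h (X w) - (X w - Y w) * W w.
    rewrite /W indicE; case: (boolP (w \in A n)) => wA; last by rewrite !mulr0 subr0.
    rewrite mulr1 mulrC subr_ge0 (le_trans _ (hgb w))// -addrA addrCA lerDl.
    exact: u0.
  have -> : (\int[P]_w (h (X w))%:E = \int[P]_w (h (X w) - (X w - Y w) * W w)%:E)%E.
    under [RHS]eq_integral do rewrite EFinB.
    by rewrite integralB// v0 sube0.
  apply: (@le_trans _ _ (\int[P]_(w in A n) (h (X w) - (X w - Y w) * W w)%:E)%E).
    apply: ge0_le_integral => //.
    - by move=> w _; rewrite lee_fin.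
    - by apply/measurable_EFinP; exact: measurable_funS mu.
    - by case/integrableP : iD => + _; apply: measurable_funS.
    move=> w wA; rewrite lee_fin /W indicE mem_set//= mulr1 /u lerBrDr.
    by rewrite (le_trans _ (hgb w))// [_ * g _]mulrC addrAC.
  apply: ge0_subset_integral => //.
  - by case/integrableP : iD.
  - by move=> w _; rewrite lee_fin.
have mono : {homo A : n m / (n <= m)%N >-> (n <= m)%O}.
  move=> n m nm; apply/subsetPset => w /= /le_trans; apply.
  by rewrite ler_nat.
have := @ge0_nondecreasing_set_cvg_integral _ _ _ A (EFin \o u) P mono mA.
rewrite (_ : \bigcup_i A i = setT); last first.
  apply/seteqP; split => // w _; exists (Num.truncn `|Y w|).+1 => //=.
  by apply: ltW; exact: truncnS_gt.
move=> /(_ _ _)/cvg_lim <- //.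
- apply: lime_le.
    apply: ereal_nondecreasing_is_cvgn.
    apply: ge0_nondecreasing_set_nondecreasing_integral => //.
    + by move=> i; apply: (@measurable_funS _ _ _ _ setT) => //; exact/measurable_EFinP.
    + by move=> i x _; rewrite /= lee_fin.
  by near=> n; exact: step.
- by move=> i; apply: (@measurable_funS _ _ _ _ setT) => //; exact/measurable_EFinP.
- by move=> i x _; rewrite /= lee_fin.
Unshelve. all: by end_near. Qed.

End conditional_expectation.

(** * Completion by null sets and almost everywhere limits *)

Section completion.
Context {d : measure_display} {T : measurableType d} {R : realType}.
Variable P : probability T R.
Implicit Types (G H : set (set T)) (f X Y : T -> R).

(** The measurable sets that agree almost everywhere with some set of [G] form a sigma-field
    containing both [G] and the null sets. *)
Lemma sigma_completion_ae G A : sub_sigma_field G -> sigma_completion P G A ->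
  measurable A /\ exists2 B, G B & {ae P, forall w, A w <-> B w}.
Proof.
move=> [sG GT].
pose C := [set A | measurable A /\
                   exists2 B, G B & {ae P, forall w, A w <-> B w}].
move: A; apply: (@smallest_sub _ _ _ C).
  have [G0 GD GU] := sG; split.
  - by split=> //; exists set0 => //; exact: aeW.
  - move=> B [mB [B' GB' BB']]; split; first exact: measurableD.
    exists (setT `\` B'); first exact: GD.
    by apply: filterS BB' => w BB'; split => -[_ ?]; split => // /BB'.
  - move=> B CB; split; first by apply: bigcupT_measurable => n; exact: (CB n).1.
    have /(_ _)/cid2 cB n := (CB n).2.
    exists (\bigcup_n (projT1 (cB n))); first by apply: GU => n; case: (cB n).
    have /ae_foralln : forall n, {ae P, forall w, B n w <-> projT1 (cB n) w}.
      by move=> n; case: (cB n).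
    apply: filterS => w Bw; split=> -[n _ nw]; exists n => //; exact/Bw.
move=> B [GB|[mB PB0]].
  by split; [exact: GT|exists B => //; exact: aeW].
split => //; exists set0; first by case: sG.
by exists B; split => // w /= wB; apply: contrapT => nBw; apply: wB.
Qed.

Lemma sub_sigma_field_completion G : sub_sigma_field G ->
  sub_sigma_field (sigma_completion P G).
Proof.
move=> sG; split; first exact: smallest_sigma_algebra.
by move=> A /(sigma_completion_ae sG)[].
Qed.

Lemma null_sets_completion G : null_sets P `<=` sigma_completion P G.
Proof. by move=> A PA; apply: sub_sigma_algebra; right. Qed.

Lemma sub_completion G : G `<=` sigma_completion P G.
Proof. by move=> A PA; apply: sub_sigma_algebra; left. Qed.

(** Changing a set by a null set changes neither integral, so the identity on [G] carries over. *)
Lemma cond_exp_completion G X Y : sub_sigma_field G ->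
  P.-integrable setT (EFin \o X) ->
  is_cond_exp P G X Y -> is_cond_exp P (sigma_completion P G) X Y.
Proof.
move=> sG iX [mY iY XY]; split => //.
  apply/measurable_wrtP; first exact: smallest_sigma_algebra.
  move=> B mB; apply: sub_completion.
  by move: B mB; apply/measurable_wrtP => //; case: sG.
have ae_int f A B : P.-integrable setT (EFin \o f) -> measurable A -> measurable B ->
    {ae P, forall w, A w <-> B w} ->
    (\int[P]_(w in A) (f w)%:E = \int[P]_(w in B) (f w)%:E)%E.
  move=> iF mA mB AB.
  rewrite integral_mkcond [RHS]integral_mkcond.
  have mf : measurable_fun setT (EFin \o f) by case/integrableP: iF.
  apply: ae_eq_integral => //.
  - by apply/(measurable_restrictT _ mA).1; exact: measurable_funS mf.
  - by apply/(measurable_restrictT _ mB).1; exact: measurable_funS mf.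
  apply: filterS AB => w AB _; rewrite !patchE.
  by rewrite (_ : (w \in A) = (w \in B))//; apply/idP/idP; rewrite !inE => /AB.
move=> A /(sigma_completion_ae sG)[mA [B GB AB]].
have mB := sG.2 _ GB.
by rewrite (ae_int Y A B)// (ae_int X A B)// XY.
Qed.

Lemma measurable_wrt_ae H f f' : sub_sigma_field H -> null_sets P `<=` H ->
  measurable_wrt H f -> measurable_fun setT f' ->
  {ae P, forall w, f w = f' w} -> measurable_wrt H f'.
Proof.
move=> sH NH mf mf' [N [mN PN ffN]].
apply/measurable_wrtP; first exact: sH.1.
move=> B mB.
have HN : H N by apply: NH.
have fB : H (f @^-1` B) by move: B mB; apply/measurable_wrtP => //; exact: sH.1.
have f'N : H (f' @^-1` B `&` N).
  apply: NH; split.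
    apply: measurableI => //.
    by rewrite -[X in measurable X]setTI; exact: mf'.
  apply: (subset_measure0 _ _ _ PN) => //.
  apply: measurableI => //.
  by rewrite -[X in measurable X]setTI; exact: mf'.
(* Off the null set [N] the two preimages coincide; the part inside [N] is null, hence in [H]. *)
have -> : f' @^-1` B = (f @^-1` B `&` ~` N) `|` (f' @^-1` B `&` N).
  apply/seteqP; split => [w /= Bw|w /=].
    have [Nw|Nw] := pselect (N w); [by right|left; split => //].
    suff <- : f' w = f w by [].
    by apply: contrapT => ff; apply: Nw; apply: ffN => /= /esym.
  move=> [[fw Nw]|[]//].
  suff -> : f' w = f w by [].
  by apply: contrapT => ff; apply: Nw; apply: ffN => /= /esym.
have sH1 := sH.1.
rewrite -(sigma_algebra_id sH1) in HN fB f'N *.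
apply: (@measurableU _ (g_sigma_algebraType H)) => //.
apply: (@measurableI _ (g_sigma_algebraType H)) => //.
exact: (@measurableC _ (g_sigma_algebraType H)).
Qed.

(** A substitute for the limit that is defined everywhere and stays measurable; [fine] sends an
    infinite upper limit to 0. *)
Definition limsup_fun (f : nat -> T -> R) (w : T) : R :=
  fine (limn_esup (fun n => (f n w)%:E)).

Lemma limsup_fun_cvg (f : nat -> T -> R) w x :
  f n w @[n --> \oo] --> x -> limsup_fun f w = x.
Proof.
move=> fx.
have fxE : (f n w)%:E @[n --> \oo] --> x%:E by apply/fine_cvgP; split => //; exact: nearW.
rewrite /limsup_fun is_cvg_limn_esupE; last by apply/cvg_ex; exists x%:E.
by rewrite (cvg_lim _ fxE).
Qed.

Lemma measurable_wrt_limsup H (f : nat -> T -> R) :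
  (forall n, measurable_wrt H (f n)) -> measurable_wrt H (limsup_fun f).
Proof.
move=> mf.
have m : measurable_fun [set: g_sigma_algebraType H]
  (fun w : g_sigma_algebraType H => limn_esup (fun n => (f n w)%:E)).
  apply: measurable_fun_limn_esup => n; apply/measurable_EFinP; exact: mf.
by apply: (measurableT_comp (@fine_measurable R setT measurableT) m).
Qed.

Lemma measurable_limsup (f : nat -> T -> R) :
  (forall n, measurable_fun setT (f n)) -> measurable_fun setT (limsup_fun f).
Proof.
move=> mf.
have m : measurable_fun [set: T] (fun w => limn_esup (fun n => (f n w)%:E)).
  apply: measurable_fun_limn_esup => n; apply/measurable_EFinP; exact: mf.
by apply: (measurableT_comp (@fine_measurable R setT measurableT) m).
Qed.

Lemma measurable_wrt_cvg H (f : nat -> T -> R) f' :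
  sub_sigma_field H -> null_sets P `<=` H ->
  (forall n, measurable_wrt H (f n)) -> measurable_fun setT f' ->
  {ae P, forall w, f n w @[n --> \oo] --> f' w} -> measurable_wrt H f'.
Proof.
move=> sH NH mf mf' ff'.
apply: (measurable_wrt_ae sH NH (measurable_wrt_limsup mf) mf').
by apply: filterS ff' => w; exact: limsup_fun_cvg.
Qed.

End completion.

(** * Convex functions: truncated powers and the square root of 1 + x^2 *)

Section convex_functions.
Context {R : realType}.
Implicit Types (p x y s t L : R).

(** Young's inequality for [t] and [s ^ (p - 1)], with the exponents [p] and [p / (p - 1)]. *)
Lemma powR_tangent_le p s t : 1 <= p -> 0 <= s -> 0 <= t ->
  s `^ p + p * s `^ (p - 1) * (t - s) <= t `^ p.
Proof.
move=> p1 s0 t0; have p0 : 0 < p by exact: lt_le_trans p1.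
rewrite mulrBr -[_ * _ * s]mulrA [_ * s]mulrC mulr_powRB1//.
(* For [p = 1] there is no finite conjugate exponent, but the inequality is then an equality. *)
have [->|pn1] := eqVneq p 1.
  by rewrite subrr powRr0 !mulr1 !mul1r !powRr1// addrCA subrr addr0.
have {}p1 : 0 < p - 1 by rewrite subr_gt0 lt_neqAle eq_sym pn1.
have := @conjugate_powR _ t (s `^ (p - 1)) p (p / (p - 1)) t0 (powR_ge0 _ _) p0.
rewrite divr_gt0// => /(_ isT); rewrite invf_div.
rewrite [X in X = _](_ : _ = 1); last by field; rewrite gt_eqF.
move=> /(_ erefl); rewrite -powRrM [(p - 1) * (p / _)]mulrCA divff ?gt_eqF// mulr1 => h.
have {}h : p * (t * s `^ (p - 1)) <= t `^ p + (p - 1) * s `^ p.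
  rewrite [leRHS](_ : _ = p * (t `^ p / p + s `^ p * ((p - 1) / p))).
    by rewrite ler_pM2l.
  by field; rewrite gt_eqF.
rewrite -subr_ge0 in h; rewrite -subr_ge0.
by apply: le_trans h _; rewrite le_eqVlt; apply/orP; left; apply/eqP; ring.
Qed.

(* The tails bound the p-th moments uniformly: being convex, they have
   expectations that decrease under conditioning. *)
Definition tail p L x := (Num.max (`|x| - L) 0) `^ p.

(** A subgradient of [tail p L]: the chain rule where [|y|] exceeds [L], and 0 where the tail
    vanishes. *)
Definition tail_slope p L y :=
  if L < `|y| then p * (`|y| - L) `^ (p - 1) * Num.sg y else 0.

Lemma tail_ge0 p L x : 0 <= tail p L x.
Proof. exact: powR_ge0. Qed.

Lemma tail0E p x : tail p 0 x = `|x| `^ p.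
Proof. by rewrite /tail subr0 max_l. Qed.

Lemma tail_le p L x : 0 <= p -> 0 <= L -> tail p L x <= `|x| `^ p.
Proof.
move=> p0 L0; apply: ge0_ler_powR => //; rewrite ?nnegrE ?le_max ?lexx ?orbT//.
by rewrite ge_max normr_ge0 gerBl L0.
Qed.

(** The tangent inequality of the power at [|y| - L], combined with
    [Num.sg y * (x - y) <= |x| - |y|]. *)
Lemma tail_tangent_le p L x y : 1 <= p ->
  tail p L y + tail_slope p L y * (x - y) <= tail p L x.
Proof.
move=> p1; have p0 : 0 < p by exact: lt_le_trans p1.
rewrite /tail_slope; case: ifPn => [Ly|]; last first.
  rewrite -leNgt => yL; rewrite mul0r addr0 [tail p L y]/tail max_r ?subr_le0//.
  by rewrite powR0 ?gt_eqF// tail_ge0.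
rewrite [tail p L y]/tail max_l ?subr_ge0 ?(ltW Ly)//.
apply: (le_trans _ (powR_tangent_le (s := `|y| - L) (t := Num.max (`|x| - L) 0) p1 _ _)).
- rewrite lerD2l -mulrA ler_wpM2l ?mulr_ge0 ?powR_ge0 ?(ltW p0)//.
  rewrite mulrBr -normrEsg.
  apply: (@le_trans _ _ (`|x| - `|y|)).
    rewrite lerB// (le_trans (ler_norm _))// normrM.
    by rewrite ler_piMl// normr_sg; case: eqP.
  rewrite opprB addrA lerB//.
  by rewrite -lerBlDr le_max lexx.
- by rewrite subr_ge0 ltW.
- by rewrite le_max lexx orbT.
Qed.

Lemma measurable_tail p L : measurable_fun setT (tail p L).
Proof.
apply: (measurableT_comp (measurable_powR p)).
apply: measurable_maxr => //.
by apply: measurable_funB => //; exact: normr_measurable.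
Qed.

Lemma measurable_tail_slope p L : measurable_fun setT (tail_slope p L).
Proof.
apply: measurable_fun_ifT => //.
- apply: measurable_fun_ltr => //; exact: normr_measurable.
- apply: measurable_funM.
    apply: measurable_funM => //.
    apply: (measurableT_comp (measurable_powR (p - 1))).
    by apply: measurable_funB => //; exact: normr_measurable.
  rewrite (_ : Num.sg = fun y : R => if y == 0 then 0 else if y < 0 then -1 else 1)//.
  apply: measurable_fun_ifT => //.
    exact: measurable_fun_eqr.
  apply: measurable_fun_ifT => //.
  exact: measurable_fun_ltr.
Qed.

Lemma tail_slope_bounded p L : 1 <= p -> 0 <= L ->
  forall K : R, exists M : R, forall y, `|y| <= K -> `|tail_slope p L y| <= M.
Proof.
move=> p1 L0 K; exists (p * K `^ (p - 1)) => y yK; rewrite /tail_slope.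
have p0 : 0 <= p by exact: le_trans p1.
case: ifPn => [Ly|]; last by rewrite normr0 mulr_ge0// powR_ge0.
rewrite !normrM (ger0_norm p0) -mulrA ler_wpM2l//.
rewrite ger0_norm ?powR_ge0// -[leRHS]mulr1 ler_pM// ?powR_ge0//.
  apply: ge0_ler_powR; rewrite ?nnegrE ?subr_ge0 ?(ltW Ly)//.
    exact: le_trans yK.
  by rewrite (le_trans _ yK)// gerBl.
by rewrite normr_sg; case: eqP.
Qed.

Definition japanese x := Num.sqrt (1 + x ^+ 2).

Lemma japanese_ge1 x : 1 <= japanese x.
Proof.
rewrite -[leLHS]sqrtr1 ler_sqrt ?lerDl ?sqr_ge0//.
by rewrite addr_ge0 ?sqr_ge0.
Qed.

Lemma sqr_japanese x : japanese x ^+ 2 = 1 + x ^+ 2.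
Proof. by rewrite sqr_sqrtr// addr_ge0// sqr_ge0. Qed.

Lemma norm_le_japanese x : `|x| <= japanese x.
Proof.
rewrite -sqrtr_sqr ler_sqrt ?lerDr//.
by rewrite addr_ge0 ?sqr_ge0.
Qed.

Lemma japanese_le x : japanese x <= 1 + `|x|.
Proof.
rewrite -[leRHS]ger0_norm ?addr_ge0// -sqrtr_sqr ler_sqrt ?sqr_ge0//.
rewrite sqrrD expr1n real_normK ?num_real// mul1r -addrA lerD2l lerDr.
by rewrite mulrn_wge0.
Qed.

Lemma measurable_japanese : measurable_fun setT japanese.
Proof.
apply: continuous_measurable_fun => x.
apply: continuous_comp; last exact: sqrt_continuous.
by apply: cvgD; [exact: cvg_cst|exact: exprn_continuous].
Qed.

(* Since [(japanese x * japanese y)^2 - (1 + x y)^2 = (x - y)^2], the error in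
   the tangent inequality at [y] is at least this quantity. *)
Definition japanese_gap x y := (x - y) ^+ 2 / (2 * japanese x * japanese y ^+ 2).

Lemma japanese_gap_ge0 x y : 0 <= japanese_gap x y.
Proof.
by rewrite divr_ge0 ?sqr_ge0// !mulr_ge0// ?sqr_ge0//; exact: le_trans (japanese_ge1 _).
Qed.

Lemma japanese_tangent_le x y :
  japanese y + y / japanese y * (x - y) + japanese_gap x y <= japanese x.
Proof.
have x0 : 0 < japanese x by exact: lt_le_trans (japanese_ge1 _).
have y0 : 0 < japanese y by exact: lt_le_trans (japanese_ge1 _).
rewrite /japanese_gap; have := sqr_japanese x; have := sqr_japanese y.
move: (japanese x) (japanese y) x0 y0 => a c a0 c0 hc ha.
rewrite -subr_ge0.
(* Once the gap is subtracted, the error in the tangent inequality is a perfect square over a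
   positive denominator. *)
have -> : a - (c + y / c * (x - y) + (x - y) ^+ 2 / (2 * a * c ^+ 2)) =
   (a * c - (1 + x * y)) ^+ 2 / (2 * a * c ^+ 2).
  apply: (@mulIf _ (2 * a * c ^+ 2)); first by rewrite gt_eqF// !mulr_gt0// exprn_gt0.
  rewrite divfK; last by rewrite gt_eqF// !mulr_gt0// exprn_gt0.
  transitivity (2 * a ^+ 2 * c ^+ 2 -
      2 * a * c * (c ^+ 2 + y * x - y ^+ 2) - (x - y) ^+ 2).
    by field; rewrite !gt_eqF.
  have -> : (x - y) ^+ 2 = a ^+ 2 * c ^+ 2 - (1 + x * y) ^+ 2 by rewrite hc ha; ring.
  by rewrite {2}hc; ring.
by rewrite divr_ge0 ?sqr_ge0// !mulr_ge0// ?sqr_ge0// ltW.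
Qed.

Lemma measurable_japanese_slope : measurable_fun setT (fun y : R => y / japanese y).
Proof.
apply: continuous_measurable_fun => x.
apply: cvgM => //; apply: cvgV.
  by rewrite gt_eqF// (lt_le_trans _ (japanese_ge1 _)).
apply: continuous_comp; last exact: sqrt_continuous.
by apply: cvgD; [exact: cvg_cst|exact: exprn_continuous].
Qed.

Lemma japanese_slope_le1 y : `|y / japanese y| <= 1.
Proof.
have y0 : 0 < japanese y by exact: lt_le_trans (japanese_ge1 _).
by rewrite normrM normfV (gtr0_norm y0) ler_pdivrMr// mul1r norm_le_japanese.
Qed.

(** The sum is at most three times its largest term, and the power of that term is one of those on
    the right. *)
Lemma powR_sum3_le p x y z : 0 <= p -> 0 <= x -> 0 <= y -> 0 <= z ->
  (x + y + z) `^ p <= 3 `^ p * (x `^ p + y `^ p + z `^ p).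
Proof.
move=> p0 x0 y0 z0; pose m := Num.max x (Num.max y z).
have m0 : 0 <= m by rewrite le_max x0.
apply: (@le_trans _ _ ((3 * m) `^ p)).
  apply: ge0_ler_powR; rewrite ?nnegrE ?addr_ge0 ?mulr_ge0//.
  rewrite [leRHS](_ : _ = m + m + m); last by ring.
  by rewrite !lerD// !le_max lexx ?orbT.
rewrite powRM// ler_wpM2l ?powR_ge0// /m.
case: (leP x (Num.max y z)) => _; last by rewrite -addrA lerDl addr_ge0 ?powR_ge0.
case: (leP y z) => _; first by rewrite lerDr addr_ge0 ?powR_ge0.
by rewrite addrAC lerDr addr_ge0 ?powR_ge0.
Qed.

End convex_functions.

(* An ultrafilter containing the tails yields all the coordinate limits at
   once, from which one subsequence is read off. *)
Lemma diagonal_subsequence {R : realType} (c : nat -> nat -> R) (M : nat -> R) :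
  (forall n i, `|c n i| <= M i) ->
  exists (x : nat -> R) (s : nat -> nat), (forall j, (j <= s j)%N) /\
    forall i, c (s j) i @[j --> \oo] --> x i.
Proof.
move=> cM.
have [U [UU sU]] := ultraFilterLemma (eventually_filter : ProperFilter \oo).
have PU : ProperFilter U := ultra_proper.
(* The image of [U] under each coordinate clusters in a compact segment, and an ultrafilter
   converges to any of its cluster points. *)
have lim i : exists x : R, forall e : R, 0 < e -> U [set n | `|c n i - x| < e].
  have cI : (c^~ i @ U) [set` `[- M i, M i]].
    by apply: (@filterE _ U) => n /=; rewrite in_itv/= -ler_norml.
  have [x [_ cx]] := @segment_compact R (- M i) (M i) (c^~ i @ U) _ cI.
  exists x => e e0.
  have [//|UC] := in_ultra_setVsetC [set n | `|c n i - x| < e] UU.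
  have cA : (c^~ i @ U) (~` ball x e).
    by apply: (@filterS _ U _ _ _ _ UC) => n /= nle; rewrite /ball/= distrC.
  by have [y []] := cx _ (ball x e) cA (nbhsx_ballx x e e0).
have [x xP] := choice lim.
have sub j : exists n, (j <= n)%N /\
    forall i, (i < j)%N -> `|c n i - x i| < j.+1%:R^-1.
  suff : U [set n | (j <= n)%N /\
      forall i, (i < j)%N -> `|c n i - x i| < j.+1%:R^-1].
    by move=> /filter_ex[n]; exists n.
  apply: filterI.
    by apply: sU; exists j.
  (* Stage [j] controls only the first [j] coordinates, since a filter is closed under finite
     intersections. *)
  suff : forall k, U [set n | forall i, (i < k)%N -> `|c n i - x i| < j.+1%:R^-1].
    exact.
  elim=> [|k IH]; first by apply: filterE.
  have := xP k j.+1%:R^-1; rewrite invr_gt0 ltr0n => /(_ isT) Uk.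
  apply: filterS2 IH Uk => n IH Uk i; rewrite ltnS leq_eqVlt => /predU1P[->//|].
  exact: IH.
have [s sP] := choice sub.
exists x, s; split => [j|i]; first by case: (sP j).
apply/cvgrPdist_lt => e e0.
near=> j.
rewrite distrC (lt_trans ((sP j).2 i _))//.
  by near: j; exists i.+1.
by near: j; exact: near_infty_natSinv_lt (PosNum e0).
Unshelve. all: by end_near. Qed.

(** * Measurable functions on atoms *)

Section atoms.
Context {d : measure_display} {T : measurableType d} {R : realType}.
Variable P : probability T R.

Lemma atomic_not_ae B : atomic P B -> ~ {ae P, forall w, ~ B w}.
Proof.
move=> [mB PB _] nB; have : P B = 0%E.
  apply: measure_negligible => //.
  by move: nB; apply: negligibleS => w /= Bw nBw.
by move=> PB0; rewrite PB0 ltxx in PB.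
Qed.

(** On an atom, each [r] is either an almost sure lower bound of [f] or almost surely above [f]; the
    constant is the supremum of the lower bounds. *)
Lemma atomic_ae_const B (f : T -> R) : atomic P B -> measurable_fun setT f ->
  exists c, {ae P, forall w, B w -> f w = c}.
Proof.
move=> aB mf; have [mB PB Bat] := aB.
pose A := [set r | {ae P, forall w, B w -> r <= f w}].
have dich r : ~ A r -> {ae P, forall w, B w -> f w < r}.
  move=> nAr.
  have mfr : measurable (f @^-1` `[r, +oo[).
    by rewrite -[X in measurable X]setTI; apply: mf => //; exact: measurable_itv.
  have mfr' : measurable (f @^-1` `]-oo, r[).
    by rewrite -[X in measurable X]setTI; apply: mf => //; exact: measurable_itv.
  have [Br0|BrB] :=
      Bat (B `&` f @^-1` `[r, +oo[) (measurableI _ _ mB mfr) (@subIsetl _ _ _).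
    exists (B `&` f @^-1` `[r, +oo[); split => //; first exact: measurableI.
    move=> w /= /not_implyP[Bw] /negP; rewrite -leNgt => rf; split => //=.
    by rewrite in_itv/= rf.
  exfalso; apply: nAr.
  exists (B `&` f @^-1` `]-oo, r[); split => //; first exact: measurableI.
    have PD : P (B `\` (B `&` f @^-1` `[r, +oo[)) =
        (P B - P (B `&` f @^-1` `[r, +oo[))%E.
      rewrite measureD ?setIA ?setIid//; first exact: measurableI.
      by rewrite -ge0_fin_numE// fin_num_measure.
    rewrite BrB subee ?fin_num_measure// in PD; rewrite -PD.
    congr (P _); apply/seteqP; split => w /=; rewrite !in_itv/= andbT.
      by move=> [Bw fr]; split => //; move=> [_]; rewrite leNgt fr.
    by move=> [Bw nfr]; split => //; rewrite ltNge; apply/negP => rf; apply: nfr.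
  move=> w /= /not_implyP[Bw] /negP; rewrite -ltNge => rf; split => //=.
have Adown r s : s <= r -> A r -> A s.
  by move=> sr; apply: filterS => w h Bw; rewrite (le_trans sr)// h.
(* Otherwise [f] would lie below every [- n] almost everywhere on the atom, although its values are
   real. The upper bound [Aub] is similar. *)
have A0 : A !=set0.
  apply: contrapT => nA; apply: (atomic_not_ae aB).
  have /ae_foralln : forall n, {ae P, forall w, B w -> f w < - n%:R}.
    by move=> n; apply: dich => An; apply: nA; exists (- n%:R).
  apply: filterS => w fn Bw; have := fn (Num.truncn `|f w|).+1 Bw.
  rewrite ltrNr => /(lt_trans (truncnS_gt _)); apply/negP.
  by rewrite -leNgt -normrN ler_norm.
have Aub : has_ubound A.
  apply: contrapT => nA; apply: (atomic_not_ae aB).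
  have /ae_foralln : forall n, {ae P, forall w, B w -> n%:R <= f w}.
    move=> n; apply: contrapT => nAn; apply: nA; exists n%:R => r Ar.
    by rewrite leNgt; apply/negP => /ltW nr; apply: nAn; exact: Adown Ar.
  apply: filterS => w fn Bw; have := fn (Num.truncn `|f w|).+1 Bw.
  move=> /(lt_le_trans (truncnS_gt _)); apply/negP.
  by rewrite -leNgt ler_norm.
exists (sup A).
have /ae_foralln lo : forall n : nat, {ae P, forall w, B w -> sup A - n.+1%:R^-1 <= f w}.
  move=> n; have [|r Ar rA] := @sup_adherent _ A n.+1%:R^-1 _ (conj A0 Aub).
    by rewrite invr_gt0 ltr0n.
  by apply: filterS Ar => w h Bw; rewrite (le_trans (ltW rA))// h.
have /ae_foralln hi : forall n : nat, {ae P, forall w, B w -> f w < sup A + n.+1%:R^-1}.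
  move=> n; apply: dich => /(ub_le_sup Aub).
  by apply/negP; rewrite -ltNge ltrDl invr_gt0 ltr0n.
apply: filterS2 lo hi => w lo hi Bw; apply/eqP; rewrite eq_le; apply/andP; split.
  apply/ler_addgt0Pr => e e0.
  have [n _ /(_ n (leqnn n)) ne] := near_infty_natSinv_lt (PosNum e0).
  by rewrite (le_trans (ltW (hi n Bw)))// lerD2l ltW.
apply/ler_addgt0Pr => e e0.
have [n _ /(_ n (leqnn n)) ne] := near_infty_natSinv_lt (PosNum e0).
rewrite -lerBlDr (le_trans _ (lo n Bw))// lerD2l lerN2 ltW//.
Qed.

(** The overlaps are null, so making the atoms disjoint keeps their probabilities, and these add up
    to 1. *)
Lemma purely_atomic_ae : purely_atomic P ->
  exists (I : set nat) (B : nat -> set T), (forall i, I i -> atomic P (B i)) /\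
    {ae P, forall w, exists2 i, I i & B i w}.
Proof.
move=> [I [B [aB BB PB]]]; exists I, B; split => //.
(* Indices outside [I] get the empty set, so that the family runs over all of [nat]. *)
pose C i := if i \in I then B i else set0.
have mC i : measurable (C i).
  by rewrite /C; case: ifPn => //; rewrite inE => /aB[].
have PCC i j : (i != j)%N -> P (C i `&` C j) = 0%E.
  rewrite /C => /eqP ij; case: ifPn => [|_]; last by rewrite set0I measure0.
  case: ifPn => [|_]; last by rewrite setI0 measure0.
  by rewrite !inE => Ij Ii; exact: BB.
have PseqDU i : P (seqDU C i) = P (C i).
  have mU : measurable (\big[setU/set0]_(k < i) C k) by exact: bigsetU_measurable.
  rewrite [RHS](measureDI _ (mC i) mU) [X in (_ + X)%E](_ : _ = 0%E) ?adde0//.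
  apply: measure_negligible; first exact: measurableI.
  rewrite big_distrr/= -(big_mkord xpredT (fun k => C i `&` C k)) big_nat_cond.
  apply: negligible_bigsetU => k; rewrite andbT => /andP[_ ki].
  apply/negligibleP; first exact: measurableI.
  by apply: PCC; rewrite gtn_eqF.
have PUC : P (\bigcup_i C i) = 1%E.
  rewrite seqDU_bigcup_eq measure_bigcup//; last first.
    by move=> i _; apply: measurableD => //; exact: bigsetU_measurable.
  transitivity (\sum_(0 <= i <oo | i \in [set: nat]) P (C i))%E.
    by apply: eq_eseriesr => i _; exact: PseqDU.
  rewrite -PB esum_mkcond (nneseries_esum (P := fun i => i \in setT))//.
  rewrite (_ : [set x | x \in setT] = setT); last first.
    by apply/seteqP; split => i //= _; rewrite inE.
  by apply: eq_esum => i _; rewrite /C; case: ifPn.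
have mUC : measurable (\bigcup_i C i) by exact: bigcupT_measurable.
exists (~` \bigcup_i C i); split; first exact: measurableC.
  by rewrite probability_setC// PUC subee.
move=> w /= nI [i _ Ciw]; apply: nI.
by move: Ciw; rewrite /C; case: ifPn => //; rewrite inE; exists i.
Qed.

End atoms.

(** * Convergence in L^p from almost everywhere convergence and domination of tails *)

Section Lp_convergence.
Context {d : measure_display} {T : measurableType d} {R : realType}.
Variable P : probability T R.

Lemma ge0_cvge0P (u : nat -> \bar R) : (forall n, 0 <= u n)%E ->
  u n @[n --> \oo] --> 0%E <->
  forall e : R, 0 < e -> \forall n \near \oo, (u n <= e%:E)%E.
Proof.
move=> u0; split=> [/fine_cvgP[uf /cvgrPdist_le ul] e e0|H].
  have := ul e e0; apply: filterS2 uf => n un /=.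
  rewrite sub0r normrN ger0_norm ?fine_ge0// => une.
  by rewrite -[u n]fineK// lee_fin.
apply/fine_cvgP; split.
  have := H 1 ltr01; apply: filterS => n un.
  by rewrite ge0_fin_numE// (le_lt_trans un)// ltry.
apply/cvgrPdist_le => e e0; have := H e e0; apply: filterS => n un /=.
rewrite sub0r normrN ger0_norm ?fine_ge0// -lee_fin fineK//.
by rewrite ge0_fin_numE// (le_lt_trans un)// ltry.
Qed.

(** Fatou's lemma, with [g] in place of the lower limit, to which it is equal almost everywhere. *)
Lemma ae_fatou_le (f : nat -> T -> R) (g : T -> R) (C : \bar R) :
  (forall n, measurable_fun setT (f n)) -> (forall n w, 0 <= f n w) ->
  measurable_fun setT g -> (forall w, 0 <= g w) ->
  {ae P, forall w, f n w @[n --> \oo] --> g w} ->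
  (forall n, \int[P]_w (f n w)%:E <= C)%E -> (\int[P]_w (g w)%:E <= C)%E.
Proof.
move=> mf f0 mg g0 fg fC.
have einf0 w : (0 <= limn_einf (fun n => (f n w)%:E))%E.
  rewrite limn_einf_lim; apply: lime_ge; first exact: is_cvg_einfs.
  apply: nearW => n; apply: le_ereal_inf_tmp => _ [k /= _ <-].
  by rewrite lee_fin.
have mE n : measurable_fun setT (EFin \o f n) by exact/measurable_EFinP.
apply: (@le_trans _ _ (\int[P]_w limn_einf (fun n => (f n w)%:E))%E).
  apply: ae_ge0_le_integral => //.
  - by move=> w _; rewrite lee_fin.
  - exact/measurable_EFinP.
  - rewrite (_ : (fun _ => _) = (fun w =>
        - limn_esup (fun n => - (f n w)%:E))%E); last first.
      apply/funext => w; rewrite -limn_einfN; congr limn_einf.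
      by apply/funext => n; exact/esym/oppeK.
    apply: measurableT_comp => //.
    apply: measurable_fun_limn_esup => n.
    exact: (measurableT_comp (f := -%E) _ (mE n)).
  - apply: filterS fg => w fw _.
    have fwE : (f n w)%:E @[n --> \oo] --> (g w)%:E.
      by apply/fine_cvgP; split => //; exact: nearW.
    by rewrite is_cvg_limn_einfE ?(cvg_lim _ fwE)//; apply/cvg_ex; exists (g w)%:E.
apply: (le_trans (fatou P measurableT mE _)).
  by move=> n w _; rewrite lee_fin.
rewrite limn_einf_lim; apply: lime_le; first exact: is_cvg_einfs.
apply: nearW => n; apply: le_trans (fC n).
by apply: ereal_inf_lbound; exists n => //=.
Qed.

Lemma powR_abs_cvg0 (p : R) (u : nat -> R) : 1 <= p ->
  u n @[n --> \oo] --> 0 -> `|u n| `^ p @[n --> \oo] --> 0.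
Proof.
move=> p1 u0; apply/cvgrPdist_le => e e0.
have /cvgrPdist_le u0' := u0.
(* Once [|u n| <= 1], its power is at most [|u n|], since [p >= 1]. *)
have := u0' (Num.min e 1); rewrite lt_min e0 ltr01 => /(_ isT).
apply: filterS => n; rewrite !sub0r !normrN le_min => /andP[une un1].
rewrite ger0_norm ?powR_ge0//.
have [->|un0] := eqVneq (u n) 0.
  by rewrite normr0 powR0 ?ltW// gt_eqF// (lt_le_trans _ p1).
by rewrite (le_trans _ une)// ge1r_powR// normr_gt0 un0.
Qed.

Variables (p : R) (p1 : 1 <= p).

Let p0 : 0 < p. Proof. exact: lt_le_trans p1. Qed.

Lemma measurable_powR_abs (f : T -> R) : measurable_fun setT f ->
  measurable_fun setT (fun w => `|f w| `^ p).
Proof.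
move=> mf; apply: (measurableT_comp (measurable_powR p)).
by apply: measurableT_comp => //; exact: normr_measurable.
Qed.

(** Dominated convergence along integer thresholds: at each point the tail vanishes once the
    threshold exceeds [|f w|], and it never exceeds the p-th power. *)
Lemma tail_integral_small (f : T -> R) : measurable_fun setT f ->
  (\int[P]_w (`|f w| `^ p)%:E < +oo)%E -> forall e : R, 0 < e ->
  exists2 L : R, 0 <= L & (\int[P]_w (tail p L (f w))%:E <= e%:E)%E.
Proof.
move=> mf fp e e0.
have mt n : measurable_fun setT (fun w => tail p n%:R (f w)).
  by apply: measurableT_comp => //; exact: measurable_tail.
have [] := @dominated_convergence _ _ _ P setT measurableT
  (fun n w => (tail p n%:R (f w))%:E) (cst 0%E) (fun w => (`|f w| `^ p)%:E).
- by move=> n; exact/measurable_EFinP.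
- by [].
- apply: aeW => w _; apply: cvg_near_cst.
  exists (Num.truncn `|f w|).+1 => // n /= wn.
  rewrite /tail max_r ?powR0 ?gt_eqF// subr_le0 ltW//.
  by apply: lt_le_trans (truncnS_gt _) _; rewrite ler_nat.
- apply/integrableP; split; first by apply/measurable_EFinP; exact: measurable_powR_abs.
  by under eq_integral do rewrite gee0_abs ?lee_fin ?powR_ge0//.
- apply: aeW => w n _ /=; rewrite lee_fin ger0_norm ?tail_ge0//.
  exact: tail_le (ltW p0) _.
move=> _ _ /=; rewrite integral0 => /ge0_cvge0P => /(_ _) H.
have [|n _ /(_ n (leqnn n)) nE] := H _ e e0.
  by move=> n; apply: integral_ge0 => w _; rewrite lee_fin tail_ge0.
by exists n%:R.
Qed.

Section tails.
Variables (f : nat -> T -> R) (f0 g : T -> R).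
Hypotheses (mf : forall n, measurable_fun setT (f n))
  (mf0 : measurable_fun setT f0) (mg : measurable_fun setT g).
Hypothesis fp : (\int[P]_w (`|f0 w| `^ p)%:E < +oo)%E.
Hypothesis fg : {ae P, forall w, f n w @[n --> \oo] --> g w}.
Hypothesis ff0 : forall n L, 0 <= L ->
  (\int[P]_w (tail p L (f n w))%:E <= \int[P]_w (tail p L (f0 w))%:E)%E.

(** Fatou's lemma for the positive parts of the tangents at [g w], evaluated at [f n w]: they lie
    below the tails of [f n], and converge to the tail of [g] because [f n w] tends to [g w]. *)
Lemma tail_integral_lim L : 0 <= L ->
  (\int[P]_w (tail p L (g w))%:E <= \int[P]_w (tail p L (f0 w))%:E)%E.
Proof.
move=> L0.
pose h n w := Num.max (tail p L (g w) + tail_slope p L (g w) * (f n w - g w)) 0.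
have mtg : measurable_fun setT (fun w => tail p L (g w)).
  by apply: measurableT_comp => //; exact: measurable_tail.
have mh n : measurable_fun setT (h n).
  apply: measurable_maxr => //; apply: measurable_funD => //.
  apply: measurable_funM; last exact: measurable_funB.
  by apply: measurableT_comp => //; exact: measurable_tail_slope.
apply: (@ae_fatou_le h) => //.
- by move=> n w; rewrite /h le_max lexx orbT.
- by move=> w; exact: tail_ge0.
- apply: filterS fg => w fw.
  have : tail p L (g w) + tail_slope p L (g w) * (f n w - g w) @[n --> \oo]
      --> tail p L (g w).
    rewrite -[X in _ --> X]addr0 -[X in _ + X](mulr0 (tail_slope p L (g w))).
    rewrite -(subrr (g w)).
    by apply: cvgD; [exact: cvg_cst|apply: cvgMr; apply: cvgB => //; exact: cvg_cst].
  move=> /cvgrPdist_le hg; apply/cvgrPdist_le => e e0.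
  apply: filterS (hg e e0) => n; apply: le_trans; rewrite /h.
  set u := _ + _ * _; have [h0|//] := leP u 0; rewrite subr0 ger0_norm ?tail_ge0//.
  by rewrite (le_trans _ (ler_norm _))// lerDl oppr_ge0.
- move=> n; apply: le_trans (ff0 n L0).
  apply: ge0_le_integral => //.
  + by move=> w _; rewrite lee_fin /h le_max lexx orbT.
  + exact/measurable_EFinP.
  + by apply/measurable_EFinP; apply: measurableT_comp => //; exact: measurable_tail.
  + by move=> w _; rewrite lee_fin /h ge_max tail_tangent_le// tail_ge0.
Qed.

Let clip L y : R := Num.max (- L) (Num.min y L).

Local Lemma clip_dist L x : 0 <= L -> `|x - clip L x| <= Num.max (`|x| - L) 0.
Proof.
move=> L0; rewrite le_max /clip; case: (leP x L) => xL.
  case: (leP (- L) x) => Lx.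
    by rewrite subrr normr0 lexx orbT.
  rewrite ltr0_norm; last by lra.
  rewrite ltr0_norm; last by lra.
  by apply/orP; left; lra.
rewrite max_r; last by lra.
rewrite gtr0_norm; last by lra.
rewrite gtr0_norm; last by lra.
by rewrite lexx.
Qed.

Local Lemma clip_lipschitz L x y : 0 <= L -> `|clip L x - clip L y| <= `|x - y|.
Proof.
move=> L0; rewrite /clip ler_norml; have := ler_norm (x - y).
have := lerNnormlW (lexx `|x - y|).
move: (`|x - y|) => z.
by case: (leP x L); case: (leP y L); case: (leP (- L) x); case: (leP (- L) y);
  case: (leP (- L) L) => *; lra.
Qed.

Local Lemma clip_bounded L x : 0 <= L -> `|clip L x| <= L.
Proof.
move=> L0; rewrite /clip ler_norml le_max lexx/= ge_max ge_min lexx orbT andbT; lra.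
Qed.

(** All functions are clipped at height [L]: the clipped parts converge by dominated convergence,
    and the clipping errors are bounded by tails, small uniformly in [n]. *)
Lemma Lp_cvg : (\int[P]_w (`|f n w - g w| `^ p)%:E)%E @[n --> \oo] --> 0%E.
Proof.
apply/ge0_cvge0P => [n|e e0].
  by apply: integral_ge0 => w _; rewrite lee_fin powR_ge0.
have C0 : 0 < 3 `^ p :> R by rewrite powR_gt0.
(* Three terms of size [e'], multiplied by [3 ^ p], add up to [e]. *)
pose e' := e / 3 `^ p / 3.
have e'0 : 0 < e' by rewrite !divr_gt0.
have [L L0 tL] := tail_integral_small mf0 fp e'0.
have mclip h : measurable_fun setT h -> measurable_fun setT (fun w : T => clip L (h w)).
  by move=> mh; apply: measurable_maxr => //; exact: measurable_minr.
pose a n w := `|clip L (f n w) - clip L (g w)| `^ p.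
have ma n : measurable_fun setT (a n).
  by apply: measurable_powR_abs; apply: measurable_funB; exact: mclip.
have [] := @dominated_convergence _ _ _ P setT measurableT
  (fun n w => (a n w)%:E) (cst 0%E) (cst ((2 * L) `^ p)%:E).
- by move=> n; exact/measurable_EFinP.
- by [].
- apply: filterS fg => w fw _.
  apply/fine_cvgP; split; first exact: nearW.
  apply: powR_abs_cvg0 => //; apply/cvgrPdist_le => r r0.
  have /cvgrPdist_le/(_ r r0) := fw; apply: filterS => n /=.
  rewrite sub0r normrN distrC; apply: le_trans; exact: clip_lipschitz.
- exact: finite_measure_integrable_cst.
- apply: aeW => w n _ /=; rewrite lee_fin ger0_norm ?powR_ge0//.
  apply: ge0_ler_powR; rewrite ?nnegrE ?mulr_ge0// ?(ltW p0)//.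
  rewrite (le_trans (ler_normB _ _))// mulr_natl mulr2n.
  by rewrite lerD// clip_bounded.
have an0 n : (0 <= \int[P]_w (a n w)%:E)%E.
  by apply: integral_ge0 => w _; rewrite lee_fin powR_ge0.
move=> _ _ /=; rewrite integral0 => /(ge0_cvge0P an0)/(_ e' e'0) aN.
apply: filterS aN => n an.
have mtail h : measurable_fun setT h -> measurable_fun setT (fun w : T => tail p L (h w)).
  by move=> mh; apply: measurableT_comp => //; exact: measurable_tail.
apply: (@le_trans _ _ (\int[P]_w ((3 `^ p)%:E *
    ((a n w)%:E + (tail p L (f n w))%:E + (tail p L (g w))%:E)))%E).
  apply: ge0_le_integral => //.
  - by apply/measurable_EFinP; apply: measurable_powR_abs; exact: measurable_funB.
  - apply: emeasurable_funM => //.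
    by apply: emeasurable_funD; [apply: emeasurable_funD|];
      apply/measurable_EFinP => //; exact: mtail.
  move=> w _; rewrite -!EFinD -EFinM lee_fin.
  apply: le_trans (powR_sum3_le (ltW p0) _ _ _) => //; rewrite ?le_max ?lexx ?orbT//.
  apply: ge0_ler_powR; rewrite ?nnegrE ?addr_ge0 ?le_max ?lexx ?orbT// ?(ltW p0)//.
  rewrite [X in `|X|](_ : _ = (clip L (f n w) - clip L (g w)) +
    (f n w - clip L (f n w)) - (g w - clip L (g w))); last by ring.
  rewrite (le_trans (ler_normB _ _))// lerD ?clip_dist//.
  by rewrite (le_trans (ler_normD _ _))// lerD ?clip_dist.
rewrite ge0_integralZl//; last 2 first.
- by apply: emeasurable_funD; [apply: emeasurable_funD|];
    apply/measurable_EFinP => //; exact: mtail.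
- by move=> w _; rewrite -!EFinD lee_fin !addr_ge0 ?powR_ge0.
rewrite ge0_integralD//; last 4 first.
- by move=> w _; rewrite -!EFinD lee_fin !addr_ge0 ?powR_ge0.
- by apply: emeasurable_funD; apply/measurable_EFinP => //; exact: mtail.
- by move=> w _; rewrite lee_fin powR_ge0.
- by apply/measurable_EFinP => //; exact: mtail.
rewrite ge0_integralD//; last 4 first.
- by move=> w _; rewrite lee_fin powR_ge0.
- by apply/measurable_EFinP => //; exact: mtail.
- by move=> w _; rewrite lee_fin powR_ge0.
- by apply/measurable_EFinP => //; exact: mtail.
rewrite [leRHS](_ : _ = (3 `^ p)%:E * (e'%:E + e'%:E + e'%:E))%E; last first.
  by rewrite -!EFinD -EFinM /e'; congr EFin; field; rewrite gt_eqF.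
apply: lee_wpmul2l; first by rewrite lee_fin ltW.
apply: leeD; [apply: leeD|].
- exact: an.
- exact: (le_trans (ff0 n L0) tL).
- exact: (le_trans (tail_integral_lim L0) tL).
Qed.

End tails.

End Lp_convergence.

(** * Moment inequalities for conditional expectations *)

Section conditional_expectation_inequalities.
Context {d : measure_display} {T : measurableType d} {R : realType}.
Variable P : probability T R.
Implicit Types (G : set (set T)) (X Y : T -> R).

(** Jensen's inequality with gap 0. The case [L = 0] is the contraction of p-th moments. *)
Lemma cond_exp_tail G X Y p L : 1 <= p -> 0 <= L -> sub_sigma_field G ->
  P.-integrable setT (EFin \o X) -> is_cond_exp P G X Y ->
  (\int[P]_w (tail p L (Y w))%:E <= \int[P]_w (tail p L (X w))%:E)%E.
Proof.
move=> p1 L0 sG iX XY.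
have := @cond_exp_jensen _ _ _ P G X Y (tail p L) (tail_slope p L) (cst 0) sG iX XY
  (measurable_tail p L) (measurable_tail_slope p L) (measurable_cst _)
  (tail_slope_bounded p1 L0) (tail_ge0 p L).
under eq_integral do rewrite addr0.
by apply=> // w; rewrite addr0; exact: tail_tangent_le.
Qed.

Lemma measurable_japanese_gap X Y : measurable_fun setT X ->
  measurable_fun setT Y -> measurable_fun setT (fun w => japanese_gap (X w) (Y w)).
Proof.
move=> mX mY.
have mj Z : measurable_fun setT Z -> measurable_fun setT (fun w : T => japanese (Z w)).
  by move=> mZ; apply: measurableT_comp => //; exact: measurable_japanese.
apply: measurable_funM; first by apply: measurable_funX; exact: measurable_funB.
under eq_fun.
  move=> w; rewrite -powR_inv1; first over.
  by rewrite !mulr_ge0 ?sqr_ge0// (le_trans _ (japanese_ge1 _)).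
apply: (measurableT_comp (measurable_powR (-1))).
apply: measurable_funM; last by apply: measurable_funX; exact: mj.
by apply: measurable_funM => //; exact: mj.
Qed.

Lemma cond_exp_japanese G X Y : sub_sigma_field G ->
  P.-integrable setT (EFin \o X) -> is_cond_exp P G X Y ->
  (\int[P]_w (japanese (Y w))%:E + \int[P]_w (japanese_gap (X w) (Y w))%:E <=
   \int[P]_w (japanese (X w))%:E)%E.
Proof.
move=> sG iX XY; have [_ iY _] := XY.
have mX := integrable_measurable iX; have mY := integrable_measurable iY.
have j0 x : 0 <= japanese x :> R by rewrite (le_trans _ (japanese_ge1 x)).
rewrite -ge0_integralD//.
- apply: (@cond_exp_jensen _ _ _ P G X Y japanese (fun y => y / japanese y)) => //.
  + exact: measurable_japanese.
  + exact: measurable_japanese_slope.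
  + exact: measurable_japanese_gap.
  + by move=> L; exists 1 => y _; exact: japanese_slope_le1.
  + by move=> w; exact: japanese_gap_ge0.
  + by move=> w; exact: japanese_tangent_le.
- by move=> w _; rewrite lee_fin.
- by apply/measurable_EFinP; apply: measurableT_comp => //; exact: measurable_japanese.
- by move=> w _; rewrite lee_fin japanese_gap_ge0.
- by apply/measurable_EFinP; exact: measurable_japanese_gap.
Qed.

Lemma cond_exp_sub G X Y Z : sub_sigma_field G ->
  P.-integrable setT (EFin \o X) -> P.-integrable setT (EFin \o Z) ->
  measurable_wrt G Z -> is_cond_exp P G X Y ->
  is_cond_exp P G (fun w => X w - Z w) (fun w => Y w - Z w).
Proof.
move=> sG iX iZ mZ [mY iY XY]; split.
- exact: (@measurable_funB _ (g_sigma_algebraType G)).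
- rewrite (_ : _ \o _ = (EFin \o Y) \- (EFin \o Z))%E//; exact: integrableB.
- move=> A GA; have mA := sG.2 _ GA.
  under eq_integral do rewrite EFinB; under [RHS]eq_integral do rewrite EFinB.
  rewrite !integralB//= ?XY//; exact: (integrableS measurableT).
Qed.

Lemma integral_japanese_lty X : P.-integrable setT (EFin \o X) ->
  (\int[P]_w (japanese (X w))%:E < +oo)%E.
Proof.
move=> iX; have mX := integrable_measurable iX.
have i1 : P.-integrable setT (fun w => (1 + `|X w|)%:E).
  rewrite (_ : (fun _ => _) = (EFin \o cst 1%R) \+ (abse \o (EFin \o X)))%E//.
  apply: integrableD => //; first exact: finite_measure_integrable_cst.
  exact: integrable_abse.
case/integrableP : i1 => _; apply: le_lt_trans; apply: ge0_le_integral => //.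
- by move=> w _; rewrite lee_fin (le_trans _ (japanese_ge1 _)).
- by apply/measurable_EFinP; apply: measurableT_comp => //; exact: measurable_japanese.
- apply/measurable_EFinP; apply: measurableT_comp; first exact: normr_measurable.
  by apply: measurable_funD => //; apply: measurableT_comp; first exact: normr_measurable.
- by move=> w _; rewrite lee_fin ger0_norm ?addr_ge0// japanese_le.
Qed.

Lemma powR_integrable X p : 1 <= p -> measurable_fun setT X ->
  (\int[P]_w (`|X w| `^ p)%:E < +oo)%E -> P.-integrable setT (EFin \o X).
Proof.
move=> p1 mX Xp.
have ip : P.-integrable setT (fun w => (1 + `|X w| `^ p)%:E).
  rewrite (_ : (fun _ => _) = (EFin \o cst 1%R) \+ (fun w => (`|X w| `^ p)%:E))%E//.
  apply: integrableD => //; first exact: finite_measure_integrable_cst.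
  apply/integrableP; split; first by apply/measurable_EFinP; exact: measurable_powR_abs.
  by under eq_integral do rewrite gee0_abs ?lee_fin ?powR_ge0//.
apply: le_integrable ip => //; first exact/measurable_EFinP.
move=> w _ /=; rewrite lee_fin [leRHS]ger0_norm ?addr_ge0 ?powR_ge0//.
have [X1|/ltW X1] := leP `|X w| 1; first by rewrite (le_trans X1)// lerDl powR_ge0.
by rewrite (le_trans (le1r_powR X1 p1))// lerDr.
Qed.

End conditional_expectation_inequalities.

(** * Convergence read off on the atoms *)

Section integrals_and_atoms.
Context {d : measure_display} {T : measurableType d} {R : realType}.
Variable P : probability T R.

Lemma le_integral_atom B (h : T -> R) (r : R) : measurable B ->
  measurable_fun setT h -> (forall w, 0 <= h w) -> 0 <= r ->
  {ae P, forall w, B w -> h w = r} ->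
  (r%:E * P B <= \int[P]_w (h w)%:E)%E.
Proof.
move=> mB mh h0 r0 hr.
have mhE : measurable_fun setT (EFin \o h) by exact/measurable_EFinP.
apply: (@le_trans _ _ (\int[P]_(w in B) (h w)%:E)%E); last first.
  by apply: ge0_subset_integral => // w _; rewrite lee_fin.
rewrite -integral_cst//; apply: ae_ge0_le_integral => //.
- by move=> w _; rewrite lee_fin.
- exact: measurable_funS mhE.
- by apply: filterS hr => w hw Bw; rewrite lee_fin hw.
Qed.

(** The atom alone contributes [|u n - v| ^ p * P B] to the integral, and [P B] is positive. *)
Lemma cvg_atom (B : set T) (p : R) (f : nat -> T -> R) (g : T -> R)
    (u : nat -> R) (v : R) : 1 <= p -> atomic P B ->
  (forall n, measurable_fun setT (f n)) -> measurable_fun setT g ->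
  (forall n, {ae P, forall w, B w -> f n w = u n}) ->
  {ae P, forall w, B w -> g w = v} ->
  (\int[P]_w (`|f n w - g w| `^ p)%:E)%E @[n --> \oo] --> 0%E ->
  u n @[n --> \oo] --> v.
Proof.
move=> p1 [mB PB _] mf mg fu gv fg.
have p0 : 0 < p by exact: lt_le_trans p1.
apply/cvgrPdist_le => e e0.
have PBf : P B \is a fin_num by exact: fin_num_measure.
have b0 : 0 < fine (P B) by rewrite fine_gt0// PB -ge0_fin_numE.
have [|+ _] := @ge0_cvge0P R (fun n => \int[P]_w (`|f n w - g w| `^ p)%:E)%E.
  by move=> n; apply: integral_ge0 => w _; rewrite lee_fin powR_ge0.
move=> /(_ fg (e `^ p * fine (P B))); rewrite mulr_gt0 ?powR_gt0// => /(_ isT).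
apply: filterS => n De.
have : ((`|u n - v| `^ p)%:E * P B <= (e `^ p * fine (P B))%:E)%E.
  apply: le_trans De; apply: le_integral_atom => //.
  - by apply: measurable_powR_abs; exact: measurable_funB.
  - by apply: filterS2 (fu n) gv => w fw gw Bw; rewrite fw// gw.
rewrite -(fineK PBf) -EFinM lee_fin ler_pM2r//.
move=> h; rewrite distrC leNgt; apply/negP => eu.
have := @gt0_ltr_powR _ p p0 e `|u n - v|; rewrite !nnegrE (ltW e0) normr_ge0.
by move=> /(_ isT isT eu); rewrite ltNge h.
Qed.

(** There are only countably many pairs of a time and an atom, so their exceptional null sets can be
    united. *)
Lemma ae_cvg_atoms (I : set nat) (B : nat -> set T)
    (f : nat -> T -> R) (g : T -> R) (u : nat -> nat -> R) (v : nat -> R) :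
  {ae P, forall w, exists2 i, I i & B i w} ->
  (forall n i, I i -> {ae P, forall w, B i w -> f n w = u n i}) ->
  (forall i, I i -> {ae P, forall w, B i w -> g w = v i}) ->
  (forall i, I i -> u n i @[n --> \oo] --> v i) ->
  {ae P, forall w, f n w @[n --> \oo] --> g w}.
Proof.
move=> IB fu gv uv.
have {}fu : {ae P, forall w, forall n i, I i -> B i w -> f n w = u n i}.
  apply: ae_foralln => n; apply: ae_foralln => i.
  have [Ii|nIi] := pselect (I i); last exact: aeW.
  by apply: filterS (fu n i Ii) => w + _.
have {}gv : {ae P, forall w, forall i, I i -> B i w -> g w = v i}.
  apply: ae_foralln => i.
  have [Ii|nIi] := pselect (I i); last exact: aeW.
  by apply: filterS (gv i Ii) => w + _.
apply: filterS3 IB fu gv => w [i Ii Bi] fu gv.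
rewrite (gv i)// (_ : (fun n => f n w) = u^~ i); first exact: uv.
by apply/funext => n; exact: fu.
Qed.

End integrals_and_atoms.

(** [a] is nonincreasing and bounded below, so its decrements tend to 0, and they dominate [g]. *)
Lemma cvg_dissipation0 {R : realType} (a g : nat -> R) : (forall n, 0 <= a n) ->
  (forall n, 0 <= g n) -> (forall n, a n.+1 + g n <= a n) ->
  g n @[n --> \oo] --> 0.
Proof.
move=> a0 g0 ag.
have ca : cvgn a.
  apply: nonincreasing_is_cvgn; last by exists 0 => _ [n _ <-].
  by apply/nonincreasing_seqP => n; rewrite (le_trans _ (ag n))// lerDl.
apply: (@squeeze_cvgr _ _ _ _ (cst 0) (fun n => a n - a n.+1)).
- by apply: nearW => n; rewrite /= g0 lerBrDl ag.
- exact: cvg_cst.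
- rewrite -(subrr (limn a)); apply: cvgB => //.
  by rewrite (cvg_shiftS a).
Qed.

(** Otherwise each value would stop occurring at some time, and no value would be left at the latest
    of these times. *)
Lemma infinite_pigeonhole (K : nat) (f : nat -> 'I_K) :
  exists k, forall N, exists2 n, (N <= n)%N & f n = k.
Proof.
apply: contrapT => /forallNP H.
have /choice[N NP] : forall k, exists N, forall n, (N <= n)%N -> f n <> k.
  move=> k; have /existsNP[N NP] := H k; exists N => n Nn fk.
  by apply: NP; exists n.
have /(_ (\max_k N k)%N) := NP (f (\max_k N k)%N).
by apply => //; exact: leq_bigmax.
Qed.

(** * Iterated conditional expectations: bounds on the atoms and a cluster point *)

Section iterated_conditional_expectations.
Context {d : measure_display} {T : measurableType d} {R : realType}.
Variable P : probability T R.
Variables (p : R) (p1 : 1 <= p) (K : nat) (H : 'I_K -> set (set T)).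
Hypothesis sH : forall k, sub_sigma_field (H k).
Hypothesis NH : forall k, null_sets P `<=` H k.
Variables (k_ : nat -> 'I_K) (X : nat -> T -> R).
Hypothesis mX0 : measurable_fun setT (X 0%N).
Hypothesis X0p : (\int[P]_w (`|X 0%N w| `^ p)%:E < +oo)%E.
Hypothesis XX : forall n, is_cond_exp P (H (k_ n)) (X n) (X n.+1).

Lemma iter_integrable n : P.-integrable setT (EFin \o X n).
Proof. by case: n => [|n]; [exact: powR_integrable X0p|case: (XX n)]. Qed.

Lemma iter_tail q n L : 1 <= q -> 0 <= L ->
  (\int[P]_w (tail q L (X n w))%:E <= \int[P]_w (tail q L (X 0%N w))%:E)%E.
Proof.
move=> q1 L0; elim: n => [|n IH]; first exact: lexx.
apply: le_trans IH.
exact: (cond_exp_tail q1 L0 (sH _) (iter_integrable n) (XX n)).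
Qed.

Let mX n : measurable_fun setT (X n) := integrable_measurable (iter_integrable n).

Let j0 (x : R) : 0 <= japanese x.
Proof. by rewrite (le_trans _ (japanese_ge1 x)). Qed.

Let jX n := fine (\int[P]_w (japanese (X n w))%:E).
Let gX n := fine (\int[P]_w (japanese_gap (X n w) (X n.+1 w))%:E).

Let jX_ge0 n : (0 <= \int[P]_w (japanese (X n w))%:E)%E.
Proof. by apply: integral_ge0 => w _; rewrite lee_fin. Qed.

Let gX_ge0 n : (0 <= \int[P]_w (japanese_gap (X n w) (X n.+1 w))%:E)%E.
Proof. by apply: integral_ge0 => w _; rewrite lee_fin japanese_gap_ge0. Qed.

Let jXE n : (\int[P]_w (japanese (X n w))%:E = (jX n)%:E)%E.
Proof.
rewrite fineK// ge0_fin_numE//; exact: integral_japanese_lty (iter_integrable n).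
Qed.

Let jgX n : (\int[P]_w (japanese (X n.+1 w))%:E +
  \int[P]_w (japanese_gap (X n w) (X n.+1 w))%:E <= (jX n)%:E)%E.
Proof.
rewrite -jXE; exact: cond_exp_japanese (sH _) (iter_integrable n) (XX n).
Qed.

Let gXE n : (\int[P]_w (japanese_gap (X n w) (X n.+1 w))%:E = (gX n)%:E)%E.
Proof.
rewrite fineK// ge0_fin_numE//.
have := jgX n; rewrite jXE; apply: contraTT; rewrite -!ltNge => h.
by move: h; rewrite ltey => /negPn/eqP ->; rewrite addey// ltry.
Qed.

Let jX_le n : jX n <= jX 0%N.
Proof.
elim: n => [|n IH]; first exact: lexx.
apply: le_trans IH; have := jgX n.
rewrite jXE gXE -EFinD lee_fin; apply: le_trans.
by rewrite lerDl fine_ge0.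
Qed.

(** Each gap is paid for by a decrease of [jX], which stays nonnegative. *)
Let gX_cvg0 : gX n @[n --> \oo] --> 0.
Proof.
apply: (@cvg_dissipation0 _ jX) => n; rewrite ?fine_ge0//.
by have := jgX n; rewrite jXE gXE -EFinD lee_fin.
Qed.

Variables (I : set nat) (B : nat -> set T).
Hypothesis aB : forall i, I i -> atomic P (B i).
Hypothesis IB : {ae P, forall w, exists2 i, I i & B i w}.
Variable c : nat -> nat -> R.
Hypothesis cX : forall n i, I i -> {ae P, forall w, B i w -> X n w = c n i}.

Let b i := fine (P (B i)).

Let b_gt0 i : I i -> 0 < b i.
Proof.
move=> /aB[mB PB _].
by rewrite fine_gt0// PB -ge0_fin_numE// fin_num_measure.
Qed.

Let bE i : I i -> (P (B i) = (b i)%:E)%E.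
Proof. by move=> /aB[mB _ _]; rewrite fineK// fin_num_measure. Qed.

(** The atom contributes [japanese (c n i) * b i] to an expectation that never exceeds its initial
    value. *)
Lemma iter_atom_bounded n i : I i -> japanese (c n i) <= jX 0%N / b i.
Proof.
move=> Ii; rewrite ler_pdivlMr ?b_gt0//; apply: le_trans (jX_le n).
rewrite -lee_fin -jXE EFinM -bE//; apply: le_integral_atom => //.
- by case: (aB Ii).
- by apply: measurableT_comp => //; exact: measurable_japanese.
- by apply: filterS (cX n Ii) => w cw Bw; rewrite cw.
Qed.

(** The gap on the atom is at most [gX n / b i], and the bound on the values keeps its denominator
    below [2 * M ^+ 3]. *)
Lemma iter_atom_step i : I i -> (c n.+1 i - c n i) @[n --> \oo] --> 0.
Proof.
move=> Ii; set M := jX 0%N / b i.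
have M0 : 0 <= M by rewrite (le_trans _ (iter_atom_bounded 0 Ii)).
have sq n : (c n i - c n.+1 i) ^+ 2 <= 2 * M ^+ 3 / b i * gX n.
  have bi := b_gt0 Ii.
  have : japanese_gap (c n i) (c n.+1 i) * b i <= gX n.
    rewrite -lee_fin EFinM -bE// -gXE; apply: le_integral_atom => //.
    - by case: (aB Ii).
    - exact: measurable_japanese_gap.
    - by move=> w; exact: japanese_gap_ge0.
    - exact: japanese_gap_ge0.
    - by apply: filterS2 (cX n Ii) (cX n.+1 Ii) => w cw cw' Bw; rewrite cw// cw'.
  rewrite -ler_pdivlMr// => gn.
  have A0 : 0 < 2 * japanese (c n i) * japanese (c n.+1 i) ^+ 2.
    by rewrite !mulr_gt0// ?exprn_gt0// (lt_le_trans _ (japanese_ge1 _)).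
  have AM : 2 * japanese (c n i) * japanese (c n.+1 i) ^+ 2 <= 2 * M ^+ 3.
    rewrite (exprS M 2) mulrA ler_pM ?mulr_ge0 ?exprn_ge0//.
      by rewrite ler_pM2l// iter_atom_bounded.
    by rewrite lerXn2r ?nnegrE// iter_atom_bounded.
  have -> : (c n i - c n.+1 i) ^+ 2 =
      2 * japanese (c n i) * japanese (c n.+1 i) ^+ 2 * japanese_gap (c n i) (c n.+1 i).
    by rewrite /japanese_gap mulrC divfK ?gt_eqF.
  rewrite [leRHS]mulrAC -[leRHS]mulrA; apply: ler_pM => //; first exact: ltW.
  exact: japanese_gap_ge0.
have : (fun n => 2 * M ^+ 3 / b i * gX n) @ \oo --> 0.
  by rewrite -(mulr0 (2 * M ^+ 3 / b i)); apply: cvgMr.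
move=> /cvgrPdist_le h; apply/cvgrPdist_le => e e0.
apply: filterS (h (e ^+ 2) _); last by rewrite exprn_gt0.
move=> n; rewrite !sub0r !normrN => he.
rewrite -(ler_pXn2r (n := 2)) ?nnegrE ?(ltW e0)//.
rewrite -normrX ger0_norm ?sqr_ge0// -sqrrN opprB.
by rewrite (le_trans (sq n))// (le_trans (ler_norm _)).
Qed.

Lemma iter_cluster : exists (x : T -> R) (y : nat -> R) (s : nat -> nat),
  [/\ measurable_fun setT x, forall j, (j <= s j)%N,
      {ae P, forall w, X (s j) w @[j --> \oo] --> x w} &
      forall i, I i -> {ae P, forall w, B i w -> x w = y i}].
Proof.
(* Indices outside [I] get value and bound 0, so that the diagonal extraction applies to a family
   over all of [nat]. *)
have cb n i : `|if i \in I then c n i else 0| <= if i \in I then jX 0%N / b i else 0.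
  case: ifPn; last by rewrite normr0.
  by rewrite inE => /(iter_atom_bounded n); apply: le_trans; exact: norm_le_japanese.
have [y [s [js cy]]] := diagonal_subsequence cb.
have {}cy i : I i -> c (s j) i @[j --> \oo] --> y i.
  by move=> Ii; have := cy i; rewrite mem_set.
pose x := limsup_fun (fun j => X (s j)).
have xy i : I i -> {ae P, forall w, B i w -> x w = y i}.
  move=> Ii.
  have /ae_foralln : forall n, {ae P, forall w, B i w -> X n w = c n i}.
    by move=> n; exact: cX.
  apply: filterS => w Xc Bw; apply: limsup_fun_cvg.
  rewrite (_ : (fun n => X (s n) w) = (fun j => c (s j) i)); first exact: cy.
  by apply/funext => j; exact: Xc.
exists x, y, s; split => //; first by apply: measurable_limsup => n; exact: mX.
apply: (ae_cvg_atoms (u := fun j => c (s j)) IB _ xy cy) => j i Ii.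
exact: cX.
Qed.

(** * From one cluster point to convergence of the whole sequence *)

Section cluster_point.
Variables (x : T -> R) (y : nat -> R) (s : nat -> nat).
Hypothesis mx : measurable_fun setT x.
Hypothesis js : forall j, (j <= s j)%N.
Hypothesis Xx : {ae P, forall w, X (s j) w @[j --> \oo] --> x w}.
Hypothesis xy : forall i, I i -> {ae P, forall w, B i w -> x w = y i}.

Let D n := (\int[P]_w (`|X n w - x w| `^ p)%:E)%E.

Let D0 n : (0 <= D n)%E.
Proof. by apply: integral_ge0 => w _; rewrite lee_fin powR_ge0. Qed.

Let Ds : D (s j) @[j --> \oo] --> 0%E.
Proof.
apply: (Lp_cvg p1 (fun j => mX (s j)) mX0 mx X0p Xx) => j L L0.
exact: (iter_tail (s j) p1 L0).
Qed.

Lemma cluster_powR_lty : (\int[P]_w (`|x w| `^ p)%:E < +oo)%E.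
Proof.
apply: le_lt_trans X0p.
under eq_integral do rewrite -tail0E; under [leRHS]eq_integral do rewrite -tail0E.
apply: (tail_integral_lim p1 (fun j => mX (s j)) mx Xx _ (lexx _)) => j L L0.
exact: (iter_tail (s j) p1 L0).
Qed.

(** Here [x] is its own conditional expectation, so [X n.+1 - x] is that of [X n - x], and the p-th
    moment contracts. *)
Lemma cluster_dist_le n : measurable_wrt (H (k_ n)) x -> (D n.+1 <= D n)%E.
Proof.
move=> mkx; rewrite /D.
under eq_integral do rewrite -tail0E; under [leRHS]eq_integral do rewrite -tail0E.
have ix := powR_integrable p1 mx cluster_powR_lty.
apply: (@cond_exp_tail _ _ _ P (H (k_ n)) _ _ p 0 p1 (lexx _)) => //.
  rewrite (_ : _ \o _ = (EFin \o X n) \- (EFin \o x))%E//.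
  by apply: integrableB => //; exact: iter_integrable.
exact: (cond_exp_sub (sH _) (iter_integrable n) ix mkx (XX n)).
Qed.

Lemma cluster_dist_homo m n : (m <= n)%N ->
  (forall l, (m <= l < n)%N -> measurable_wrt (H (k_ l)) x) -> (D n <= D m)%E.
Proof.
move=> /subnK <-; elim: (n - m)%N => [|l IH] ml; first by rewrite add0n.
rewrite addSn; apply: le_trans (cluster_dist_le _) (IH _).
  by apply: ml; rewrite leq_addl addSn ltnSn.
by move=> l' /andP[ml' l'l]; apply: ml; rewrite ml' addSn ltnS ltnW.
Qed.

(** The distances [D (q j)] are squeezed to 0 by those along [s], and convergence in L^p forces
    convergence on each atom. *)
Lemma cvg_dist_subsequence (q : nat -> nat) : (forall j, (D (q j) <= D (s j))%E) ->
  forall i, I i -> c (q j) i @[j --> \oo] --> y i.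
Proof.
move=> qs i Ii.
have Dq : D (q j) @[j --> \oo] --> 0%E.
  apply: (@squeeze_cvge _ _ _ _ (cst 0%E) _ (fun j => D (s j))).
  - by apply: nearW => j; rewrite qs andbT; exact: D0.
  - exact: cvg_cst.
  - exact: Ds.
apply: (cvg_atom (f := fun j => X (q j)) p1 (aB Ii) _ mx _ (xy Ii) Dq).
  by move=> n; exact: mX.
by move=> n; exact: cX.
Qed.

(* Until the first letter [k] for which [x] is not [H k]-measurable, the
   distance to [x] does not increase; and [X n.+1 - X n] tends to
   zero on every atom, so that [x] is also a limit of [H k]-measurable functions. *)
Lemma cluster_eventually_measurable :
  exists n0, forall n, (n0 <= n)%N -> measurable_wrt (H (k_ n)) x.
Proof.
apply: contrapT => /forallNP nmx.
have first m : exists n, [/\ (m <= n)%N, ~ measurable_wrt (H (k_ n)) x &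
    forall l, (m <= l < n)%N -> measurable_wrt (H (k_ l)) x].
  have ex : exists n, (m <= n)%N && `[< ~ measurable_wrt (H (k_ n)) x >].
    have /existsNP[n /not_implyP[mn nm]] := nmx m.
    by exists n; rewrite mn; apply/asboolP.
  have [n /andP[mn /asboolP nn] nmin] := ex_minnP ex.
  exists n; split => // l /andP[ml ln]; apply: contrapT => nl.
  by have := nmin l; rewrite ml/= => /(_ (asboolT nl)); rewrite leqNgt ln.
have [m mP] := choice first.
(* One letter [k] is the first bad one after [s j] for infinitely many [j]; [r] selects such [j],
   and [q] gives the times at which [k] is used. *)
have [k kP] := infinite_pigeonhole (fun j => k_ (m (s j))).
have /choice[r rP] : forall N, exists j, (N <= j)%N /\ k_ (m (s j)) = k.
  by move=> N; have [j Nj jk] := kP N; exists j.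
pose q j := m (s (r j)).
have [_ nk _] := mP (s (r 0%N)); apply: nk; rewrite (rP 0%N).2.
have rinf : r j @[j --> \oo] --> \oo.
  move=> A [N _ NA]; exists N => // j /= Nj; apply: NA => /=.
  exact: leq_trans Nj (rP j).1.
have qinf : q j @[j --> \oo] --> \oo.
  move=> A [N _ NA]; exists N => // j /= Nj; apply: NA => /=.
  have [sm _ _] := mP (s (r j)).
  by apply: leq_trans sm; apply: leq_trans (js _); exact: leq_trans Nj (rP j).1.
(* Between [s j] and [m (s j)] the distance to [x] does not increase, by the choice of [m]. *)
have cms i : I i -> c (m (s j)) i @[j --> \oo] --> y i.
  apply: (@cvg_dist_subsequence (fun j => m (s j))) => j.
  by have [sm _ ?] := mP (s j); exact: cluster_dist_homo.
(* Step [q j] conditions on [H k], so it is [X (q j).+1] that is measurable for [H k]; on each atom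
   it differs from [X (q j)] by a vanishing increment. *)
apply: (measurable_wrt_cvg (f := fun j => X (q j).+1) (sH k) (@NH k) _ mx).
  by move=> j; rewrite -(rP j).2; case: (XX (q j)).
apply: (ae_cvg_atoms (u := fun j => c (q j).+1) IB _ xy).
  by move=> j i Ii; exact: cX.
move=> i Ii.
have -> : y i = 0 + y i by rewrite add0r.
rewrite (_ : (fun j => c (q j).+1 i) = fun j =>
    (c (q j).+1 i - c (q j) i) + c (q j) i); last first.
  by apply/funext => j; rewrite subrK.
apply: cvgD.
  exact: (cvg_comp _ _ qinf (iter_atom_step Ii)).
exact: (cvg_comp _ _ rinf (cms i Ii)).
Qed.

(** From [n0] on the distance is nonincreasing, and the subsequence makes it small at some time
    after [n0]. *)
Lemma cluster_Lp_cvg : D n @[n --> \oo] --> 0%E.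
Proof.
have [n0 n0P] := cluster_eventually_measurable.
apply/(ge0_cvge0P D0) => e e0.
have /(ge0_cvge0P (fun j => D0 (s j)))/(_ e e0)[j1 _ j1P] := Ds.
have De := j1P (maxn j1 n0) (leq_maxl _ _).
exists (s (maxn j1 n0)) => [//|n /= sn]; apply: le_trans De.
apply: cluster_dist_homo => // l /andP[sl _]; apply: n0P.
by apply: leq_trans sl; apply: leq_trans (js _); exact: leq_maxr.
Qed.

Lemma cluster_ae_cvg : {ae P, forall w, X n w @[n --> \oo] --> x w}.
Proof.
apply: (ae_cvg_atoms (u := c) IB _ xy); first by move=> n i Ii; exact: cX.
move=> i Ii.
by apply: (cvg_atom p1 (aB Ii) mX mx _ (xy Ii) cluster_Lp_cvg) => n; exact: cX.
Qed.

(** [Lp_cvg] is applied with exponent 1, for which the tails are dominated as well; integrals over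
    sets pass to the limit through this distance. *)
Lemma cluster_L1_cvg : (\int[P]_w (`|X n w - x w|)%:E)%E @[n --> \oo] --> 0%E.
Proof.
have X1 : (\int[P]_w (`|X 0%N w| `^ 1)%:E < +oo)%E.
  under eq_integral do rewrite powRr1//.
  by case/integrableP : (iter_integrable 0).
have X1tail n L : 0 <= L ->
    (\int[P]_w (tail 1 L (X n w))%:E <= \int[P]_w (tail 1 L (X 0%N w))%:E)%E.
  exact: (iter_tail n (lexx 1)).
have := Lp_cvg (lexx 1) mX mX0 mx X1 cluster_ae_cvg X1tail.
rewrite (_ : (fun n => _) = (fun n => \int[P]_w (`|X n w - x w|)%:E)%E)//.
by apply/funext => n; apply: eq_integral => w _; rewrite powRr1.
Qed.

End cluster_point.

End iterated_conditional_expectations.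

(** * The norm of L^p in terms of p-th moments *)

Section Lp_norm.
Context {d : measure_display} {T : measurableType d} {R : realType}.
Variables (P : probability T R) (p : R).
Hypothesis p1 : 1 <= p.

Let p0 : 0 < p. Proof. exact: lt_le_trans p1. Qed.

Lemma LnormE (f : T -> R) : ('N[P]_p%:E[EFin \o f] =
  (\int[P]_w (`|f w| `^ p)%:E) `^ p^-1)%E.
Proof. by rewrite unlock; congr (_ `^ _)%E; apply: eq_integral. Qed.

Lemma LfunP_powR (f : T -> R) : f \in Lfun P p%:E <->
  measurable_fun setT f /\ (\int[P]_w (`|f w| `^ p)%:E < +oo)%E.
Proof.
split=> [fL|[mf fp]].
  split; first by have := sub_Lfun_mfun fL; rewrite inE.
  have /integrableP[_] := Lfun_integrable p1 fL.
  by under eq_integral do rewrite gee0_abs ?lee_fin ?powR_ge0//.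
rewrite inE; apply/andP; split; rewrite inE//=.
by rewrite /finite_norm LnormE poweR_lty.
Qed.

Lemma cvg_Lnorm (f : nat -> T -> R) :
  (\int[P]_w (`|f n w| `^ p)%:E)%E @[n --> \oo] --> 0%E ->
  ('N[P]_p%:E[EFin \o f n])%E @[n --> \oo] --> 0%E.
Proof.
have fn0 n : (0 <= \int[P]_w (`|f n w| `^ p)%:E)%E.
  by apply: integral_ge0 => w _; rewrite lee_fin powR_ge0.
move=> /(ge0_cvge0P fn0) f0; apply/ge0_cvge0P => [n|e e0]; first exact: Lnorm_ge0.
apply: filterS (f0 (e `^ p) _); last by rewrite powR_gt0.
move=> n fe; rewrite LnormE.
have -> : e%:E = ((e `^ p)%:E `^ p^-1)%E.
  by rewrite poweR_EFin -powRrM divff ?gt_eqF// powRr1// ltW.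
have q0 : 0 <= p^-1 by rewrite invr_ge0 ltW.
by apply: (gt0_ler_poweR q0 _ _ fe); rewrite in_itv/= leey andbT ?fn0 ?lee_fin ?powR_ge0.
Qed.

End Lp_norm.

(** * Convergence of the iterates and identification of their limit *)

Theorem theorem1p3 (d : measure_display) (T : measurableType d) (R : realType)
    (P : probability T R) (hP : purely_atomic P)
    (K : nat) (hK : (0 < K)%N)
    (G : 'I_K -> set (set T)) (hG : forall k, sub_sigma_field (G k))
    (F : nat -> set (set T)) (hF : forall n : nat, exists k, F n.+1 = G k)
    (p : R) (hp : 1 <= p)
    (X : nat -> T -> R) (hX0 : X 0%N \in Lfun P p%:E)
    (hX : forall n : nat, is_cond_exp P (F n.+1) (X n) (X n.+1)) :
  exists Xoo : T -> R,
    [/\ Xoo \in Lfun P p%:E,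
        ('N[P]_p%:E[EFin \o (X n \- Xoo)%R])%E @[n --> \oo] --> 0%E,
        {ae P, forall w, X n w @[n --> \oo] --> Xoo w} &
        (forall (k : 'I_K) (m : nat), exists n : nat, (m < n)%N /\ F n = G k) ->
        is_cond_exp P (\bigcap_(k in [set: 'I_K]) sigma_completion P (G k))
          (X 0%N) Xoo].
Proof.
have [k_ Fk] := choice hF.
(* The iterates remain conditional expectations for the completed sigma-fields, whose measurable
   functions are stable under almost everywhere limits. *)
pose H k := sigma_completion P (G k).
have sH k : sub_sigma_field (H k) by exact: sub_sigma_field_completion.
have NH k : null_sets P `<=` H k by exact: null_sets_completion.
have [mX0 X0p] := (LfunP_powR P hp (X 0%N)).1 hX0.
have iX n : P.-integrable setT (EFin \o X n).
  by case: n => [|n]; [exact: powR_integrable X0p|case: (hX n)].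
have XX n : is_cond_exp P (H (k_ n)) (X n) (X n.+1).
  by apply: cond_exp_completion => //; rewrite -Fk.
have mX n : measurable_fun setT (X n) := integrable_measurable (iX n).
have [I [B [aB IB]]] := purely_atomic_ae hP.
(* A single choice over pairs of a time and an index; the value is 0 for indices outside [I]. *)
have /choice[c cX] : forall ni : nat * nat, exists r : R,
    I ni.2 -> {ae P, forall w, B ni.2 w -> X ni.1 w = r}.
  move=> [n i] /=; have [Ii|nIi] := pselect (I i); last by exists 0.
  by have [r rP] := atomic_ae_const (aB i Ii) (mX n); exists r.
have {}cX n i : I i -> {ae P, forall w, B i w -> X n w = c (n, i)}.
  exact: cX (n, i).
have [x [y [s [mx js Xx xy]]]] := iter_cluster hp sH mX0 X0p XX aB IB cX.
have xp := cluster_powR_lty hp sH mX0 X0p XX mx Xx.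
have ix := powR_integrable hp mx xp.
have XL1 := cluster_L1_cvg hp sH NH mX0 X0p XX aB IB cX mx js Xx xy.
exists x; split.
- exact/(LfunP_powR P hp x).
- apply: (cvg_Lnorm hp (f := fun n => (X n \- x)%R)).
  exact: (cluster_Lp_cvg hp sH NH mX0 X0p XX aB IB cX mx js Xx xy).
- exact: (cluster_ae_cvg hp sH NH mX0 X0p XX aB IB cX mx js Xx xy).
move=> GF.
have [n0 n0P] := cluster_eventually_measurable hp sH NH mX0 X0p XX aB IB cX mx js Xx xy.
have Hx k : measurable_wrt (H k) x.
  (* An occurrence of [G k] after [n0.+1] is some [F n.+1], the sigma-field leading from [X n] to
     [X n.+1], with [n0 <= n]. *)
  have [m [n0m Fm]] := GF k n0.+1; case: m n0m Fm => [//|n n0n Fn].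
  have -> : H k = H (k_ n) by rewrite /H -Fn Fk.
  by apply: n0P; rewrite -ltnS ltnW.
split => //.
- apply/measurable_wrtP; first by apply: sigma_algebra_bigcap => k _; exact: (sH k).1.
  move=> A mA k _; move: A mA; apply/measurable_wrtP; first exact: (sH k).1.
  exact: Hx.
move=> A HA.
have mA : measurable A by apply: (sH (k_ 0%N)).2; exact: HA.
(* [A] lies in every [H k], so no conditioning changes the integral over it. *)
have XA n : (\int[P]_(w in A) (X n w)%:E = \int[P]_(w in A) (X 0%N w)%:E)%E.
  elim: n => [//|n <-]; have [_ _] := XX n; apply.
  exact: HA.
have iA f : P.-integrable setT (EFin \o f) -> P.-integrable A (EFin \o f).
  exact: integrableS.
have fA f : P.-integrable setT (EFin \o f) ->
    (\int[P]_(w in A) (f w)%:E)%E \is a fin_num.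
  by move=> iF; apply: integrable_fin_num => //; exact: iA.
(* By [XA], [X 0] may be replaced by [X n], whose integral over [A] differs from that of [x] by at
   most their L^1 distance. *)
have le_e (e : R) : 0 < e ->
    `|fine (\int[P]_(w in A) (X 0%N w)%:E)%E - fine (\int[P]_(w in A) (x w)%:E)%E| <= e.
  move=> e0.
  have XL0 n : (0 <= \int[P]_w (`|X n w - x w|)%:E)%E.
    by apply: integral_ge0 => w _; rewrite lee_fin.
  have [n _ /(_ n (leqnn n)) Xn] := (ge0_cvge0P XL0).1 XL1 e e0.
  have mXx : measurable_fun setT (fun w => X n w - x w) by exact: measurable_funB.
  rewrite -lee_fin -abse_EFin.
  apply: le_trans Xn.
  have -> : (fine (\int[P]_(w in A) (X 0%N w)%:E) - fine (\int[P]_(w in A) (x w)%:E))%:E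
      = (\int[P]_(w in A) (X n w - x w)%:E)%E.
    rewrite EFinB !fineK ?fA// -(XA n).
    under [RHS]eq_integral do rewrite EFinB.
    by rewrite integralB//; exact: iA.
  apply: le_trans (le_abse_integral _ _ _) _ => //.
    by apply/measurable_EFinP; exact: measurable_funS mXx.
  apply: ge0_subset_integral => //.
  by apply/measurable_EFinP; apply: measurableT_comp => //; exact: normr_measurable.
apply/esym; rewrite -[LHS]fineK ?fA// -[RHS]fineK ?fA//; congr EFin.
apply/eqP; rewrite -subr_eq0 -normr_le0; apply/ler_addgt0Pr => e e0.
by rewrite add0r; exact: le_e.
Qed.
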